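(* Let $S$ be an F-finite regular local ring of prime characteristic $p$ (respectively, a polynomial ring over a field $k$ of characteristic $p$ with $[k:k^p]<\infty$), let $f\in S$ be an element (respectively, a homogeneous element), let $q=p^e$ be a power of $p$, and let $R=S[f^{1/q}]$. Then $R$ has finite F-representation type. In particular, if $k$ is a field of characteristic $p$ with $[k:k^p]<\infty$ and $p\in\{2,3,7\}$, then the ring $k[x,y,z]/(x^2+y^3+z^7)$ has finite F-representation type.
   Context: All rings are commutative Noetherian of prime characteristic $p$; $\mathbb N=\{0,1,2,\dots\}$. For a ring $R$, an $R$-module $M$ and $e\in\mathbb N$, ${}^eM$ denotes the $R$-module which equals $M$ as an abelian group, with $R$-action $r\cdot m:=r^{p^e}m$. $R$ is F-finite if ${}^1R$ is a finitely generated $R$-module. $R$ has finite F-representation type if there are finitely many finitely generated $R$-modules $M_1,\dots,M_s$ such that for every $e\in\mathbb N$ there are nonnegative integers $n_{e,1},\dots,n_{e,s}$ with ${}^eR\cong\bigoplus_{i=1}^s M_i^{\oplus n_{e,i}}$ as $R$-modules. Here $S^{1/q}$ is the ring of $q$-th roots of elements of the domain $S$ (inside an algebraic closure of $\operatorname{Frac}(S)$), and $S[f^{1/q}]\subset S^{1/q}$ is the $S$-subalgebra generated by the $q$-th root of $f$. In the polynomial ring case, $S$ is $\mathbb N$-graded with $k$ in degree $0$ and each variable homogeneous of some positive degree (the degrees of the variables need not be $1$). *)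

(* Defs.v *)
From HB Require Import structures.
From mathcomp Require Import all_boot all_order all_algebra.
From mathcomp Require Import boolp.
From mathcomp Require Import mpoly.

Set Implicit Arguments.
Unset Strict Implicit.
Unset Printing Implicit Defensive.

Import GRing.Theory.
Local Open Scope ring_scope.


Definition lmod_iso (R : nzRingType) (M N : lmodType R) : Prop :=
  exists phi : {linear M -> N}, bijective phi.

Definition fg_module (R : nzRingType) (M : lmodType R) : Prop :=
  exists (n : nat) (g : 'I_n -> M),
    forall x : M, exists c : 'I_n -> R, x = \sum_i c i *: g i.

(* A dependent finite function type has no module structure in the library. *)
Definition dirsum (R : nzRingType) (I : finType) (M : I -> lmodType R) : Type :=
  {dffun forall i : I, M i}.

Section DirSum.
Variables (R : nzRingType) (I : finType) (M : I -> lmodType R).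
Local Notation T := (dirsum M).
Implicit Types (u v w : T) (a b : R).

HB.instance Definition _ := Choice.copy T {dffun forall i : I, M i}.

Definition dirsum_zero : T := [ffun i => 0 : M i].
Definition dirsum_opp (u : T) : T := [ffun i => - u i : M i].
Definition dirsum_add (u v : T) : T := [ffun i => u i + v i : M i].
Definition dirsum_scale (a : R) (u : T) : T := [ffun i => a *: u i : M i].

Fact dirsum_addA : associative dirsum_add.
Proof. by move=> u v w; apply/ffunP=> i; rewrite !ffunE addrA. Qed.
Fact dirsum_addC : commutative dirsum_add.
Proof. by move=> u v; apply/ffunP=> i; rewrite !ffunE addrC. Qed.
Fact dirsum_add0 : left_id dirsum_zero dirsum_add.
Proof. by move=> u; apply/ffunP=> i; rewrite !ffunE add0r. Qed.
Fact dirsum_addN : left_inverse dirsum_zero dirsum_opp dirsum_add.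
Proof. by move=> u; apply/ffunP=> i; rewrite !ffunE addNr. Qed.

HB.instance Definition _ :=
  GRing.isZmodule.Build T dirsum_addA dirsum_addC dirsum_add0 dirsum_addN.

Fact dirsum_scaleA a b u :
  dirsum_scale a (dirsum_scale b u) = dirsum_scale (a * b) u.
Proof. by apply/ffunP=> i; rewrite !ffunE scalerA. Qed.
Fact dirsum_scale1 : left_id 1 dirsum_scale.
Proof. by move=> u; apply/ffunP=> i; rewrite !ffunE scale1r. Qed.
Fact dirsum_scaleDr : right_distributive dirsum_scale +%R.
Proof. by move=> a u v; apply/ffunP=> i; rewrite !ffunE scalerDr. Qed.
Fact dirsum_scaleDl u : {morph dirsum_scale^~ u : a b / a + b}.
Proof. by move=> a b; apply/ffunP=> i; rewrite !ffunE scalerDl. Qed.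

HB.instance Definition _ := GRing.Zmodule_isLmodule.Build R T
  dirsum_scaleA dirsum_scale1 dirsum_scaleDr dirsum_scaleDl.
End DirSum.

(* The module ^eM: the abelian group M with r acting as r ^+ (p ^ e).  The
   proof that R has characteristic p makes this action additive in r. *)
Definition frob_push (R : comNzRingType) (p : nat) (charR : p \in [pchar R])
  (e : nat) (M : lmodType R) : Type := M.

Section FrobPush.
Variables (R : comNzRingType) (p : nat) (charR : p \in [pchar R]).
Variables (e : nat) (M : lmodType R).
Local Notation T := (frob_push charR e M).

HB.instance Definition _ := GRing.Zmodule.copy T M.

Definition frob_scale (r : R) (m : T) : T := (r ^+ (p ^ e) *: (m : M) : M).

Fact frob_scaleA a b (u : T) :
  frob_scale a (frob_scale b u) = frob_scale (a * b) u.
Proof. by rewrite /frob_scale scalerA exprMn. Qed.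
Fact frob_scale1 : left_id 1 frob_scale.
Proof. by move=> u; rewrite /frob_scale expr1n scale1r. Qed.
Fact frob_scaleDr : right_distributive frob_scale +%R.
Proof. by move=> a u v; rewrite /frob_scale -scalerDr. Qed.
Fact frob_scaleDl (u : T) : {morph frob_scale^~ u : a b / a + b}.
Proof.
move=> a b; rewrite /frob_scale -[RHS](@scalerDl _ M); congr (_ *: _).
elim: e => [|e' IH]; first by rewrite expn0 !expr1.
by rewrite expnSr !exprM IH -!(pFrobenius_autE charR) rmorphD.
Qed.

HB.instance Definition _ := GRing.Zmodule_isLmodule.Build R T
  frob_scaleA frob_scale1 frob_scaleDr frob_scaleDl.
End FrobPush.

Definition F_finite (p : nat) (R : comNzRingType) : Prop :=
  exists charR : p \in [pchar R], fg_module (frob_push charR 1 R^o).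

Definition FFRT (p : nat) (R : comNzRingType) : Prop :=
  exists (charR : p \in [pchar R]) (s : nat) (M : 'I_s -> lmodType R),
    (forall i, fg_module (M i)) /\
    (forall e : nat, exists n : 'I_s -> nat,
       lmod_iso (frob_push charR e R^o)
                (dirsum (fun i : 'I_s => {ffun 'I_(n i) -> M i}))).


Section RegularLocal.
Variable R : comNzRingType.
Implicit Types I P m : {pred R}.

(* idealr_closed describes proper ideals. *)
Definition prime_ideal P : Prop := idealr_closed P /\ prime_idealr_closed P.

Definition maximal_ideal m : Prop :=
  idealr_closed m /\
  (forall J : {pred R}, idealr_closed J -> {subset m <= J} -> {subset J <= m}).

Definition ideal_gen_by_n I (n : nat) : Prop :=
  exists g : 'I_n -> R,
    forall x : R, x \in I <-> exists c : 'I_n -> R, x = \sum_i c i * g i.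

(* The unit ideal, not covered by idealr_closed, is generated by 1. *)
Definition noetherian : Prop :=
  forall I, idealr_closed I -> exists n, ideal_gen_by_n I n.

Definition local_with m : Prop :=
  maximal_ideal m /\ (forall m' : {pred R}, maximal_ideal m' -> m' =i m).

Definition prime_chain (d : nat) : Prop :=
  exists P : 'I_d.+1 -> {pred R},
    (forall i, prime_ideal (P i)) /\
    (forall i j : 'I_d.+1, (i < j)%N ->
       {subset P i <= P j} /\ ~ {subset P j <= P i}).

Definition krull_dim (d : nat) : Prop :=
  prime_chain d /\ (forall n, prime_chain n -> (n <= d)%N).

Definition regular_local : Prop :=
  noetherian /\
  exists m : {pred R}, local_with m /\
  exists d : nat, [/\ krull_dim d, ideal_gen_by_n m d &
    forall n, ideal_gen_by_n m n -> (d <= n)%N].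
End RegularLocal.


(* The image in L of S[X] under evaluation at g. *)
Definition adjoin_pred (S L : comNzRingType) (iota : {rmorphism S -> L}) (g : L) :
    {pred L} :=
  fun x => `[< exists P : {poly S}, x = (map_poly iota P).[g] >].

Section Adjoin.
Variables (S L : comNzRingType) (iota : {rmorphism S -> L}) (g : L).

Fact adjoin_closed : subring_closed (adjoin_pred iota g).
Proof.
split.
- by apply/asboolP; exists 1; rewrite rmorph1 hornerC.
- move=> x y /asboolP[P ->] /asboolP[Q ->]; apply/asboolP; exists (P - Q).
  by rewrite rmorphB hornerD hornerN.
- move=> x y /asboolP[P ->] /asboolP[Q ->]; apply/asboolP; exists (P * Q).
  by rewrite rmorphM hornerM.
Qed.

HB.instance Definition _ :=
  GRing.isSubringClosed.Build L (adjoin_pred iota g) adjoin_closed.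

Record adjoin : Type :=
  Adjoin { adjoin_val : L; _ : adjoin_val \in adjoin_pred iota g }.

HB.instance Definition _ := [isSub for adjoin_val].
HB.instance Definition _ := [Choice of adjoin by <:].
HB.instance Definition _ := [SubChoice_isSubComNzRing of adjoin by <:].
End Adjoin.

(* L is algebraically closed by its type. *)
Definition algebraic_closure (F : fieldType) (L : closedFieldType)
    (iota : {rmorphism F -> L}) : Prop :=
  forall x : L, algebraicOver iota x.

Definition to_closure (S : idomainType) (L : closedFieldType)
    (iota : {rmorphism {fraction S} -> L}) : {rmorphism S -> L} :=
  iota \o @FracField.tofrac S.


(* The p-th powers form a subfield k^p when p is the characteristic of k. *)
Definition pth_power (p : nat) (k : fieldType) (x : k) : Prop :=
  exists y : k, x = y ^+ p.

(* [K : F] is finite, for a subfield F of K. *)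
Definition finite_degree (K : fieldType) (F : K -> Prop) : Prop :=
  exists (n : nat) (b : 'I_n -> K), forall x : K,
    exists c : 'I_n -> K, (forall i, F (c i)) /\ x = \sum_i c i * b i.

(* The degree of a monomial when the i-th variable has degree w i. *)
Definition wdeg (n : nat) (w : 'I_n -> nat) (m : 'X_{1..n}) : nat :=
  (\sum_(i < n) m i * w i)%N.

Section WDeg.
Variables (n : nat) (w : 'I_n -> nat).

Fact wdeg0 : wdeg w 0%MM = 0%N.
Proof. by rewrite /wdeg big1 // => i _; rewrite mnm0E. Qed.
Fact wdegD : {morph wdeg w : m1 m2 / (m1 + m2)%MM >-> (m1 + m2)%N}.
Proof.
by move=> m1 m2; rewrite /wdeg -big_split; apply: eq_bigr => i _;
   rewrite mnmDE mulnDl.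
Qed.

HB.instance Definition _ := isMeasure.Build n (wdeg w) wdeg0 wdegD.
End WDeg.

Definition whomogeneous (n : nat) (k : fieldType) (w : 'I_n -> nat)
    (f : {mpoly k[n]}) : Prop :=
  exists d : nat, f \is ishomog1 d (wdeg w).

Section X2Y3Z7.
Variable k : fieldType.

Definition x2y3z7 : {mpoly k[3]} :=
  let x := 'X_(@Ordinal 3 0 isT) in
  let y := 'X_(@Ordinal 3 1 isT) in
  let z := 'X_(@Ordinal 3 2 isT) in
  x ^+ 2 + y ^+ 3 + z ^+ 7.

Definition x2y3z7_ideal : {pred {mpoly k[3]}} :=
  fun h => `[< exists a : {mpoly k[3]}, h = a * x2y3z7 >].

Fact x2y3z7_idealr_closed : idealr_closed x2y3z7_ideal.
Proof.
split.
- by apply/asboolP; exists 0; rewrite mul0r.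
- apply/asboolP => -[a /(congr1 (meval (fun=> 0)))].
  rewrite /x2y3z7 rmorph1 rmorphM !rmorphD !rmorphXn /= !mevalXU !expr0n /= !addr0 mulr0.
  by move/eqP; rewrite oner_eq0.
- move=> a u v /asboolP[b ->] /asboolP[c ->]; apply/asboolP.
  by exists (a * b + c); rewrite mulrDl mulrA.
Qed.

HB.instance Definition _ :=
  isIdealr.Build {mpoly k[3]} x2y3z7_ideal x2y3z7_idealr_closed.
End X2Y3Z7.

Definition x2y3z7_ring (k : fieldType) : comNzRingType :=
  {ideal_quot (@x2y3z7_ideal k)}.

(* Main.v *)
From HB Require Import structures.
Require Import Defs.
From mathcomp Require Import all_boot all_order all_algebra.
From mathcomp Require Import boolp mpoly.
From mathcomp Require Import ring.

Set Implicit Arguments.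
Unset Strict Implicit.
Unset Printing Implicit Defensive.

Import GRing.Theory.
Local Open Scope ring_scope.

(** Write q = p ^ e. The three cases share one mechanism. Suppose that [S] is free of
    finite rank over its own Frobenius, that [R] is a free [S]-algebra of finite rank,
    and that every q-th power of an element of [R] lies in [S]; put [phi r = r ^ q].
    For k >= e an element r acts on the module ^k R as multiplication by
    phi(r) ^ (p ^ (k - e)). A basis of [R] over the p ^ (k - e)-th powers of [S] exists,
    and in the coordinates of such a basis r acts through phi(r): thus ^k R is a direct
    sum of copies of the single module [pullback phi], the group of [S] on which r acts
    as phi(r). With ^0 R, ..., ^(e-1) R this gives a finite list ([FFRT_criterion]).

    For R = S[g] with g ^ q = f in [S], let n be the least power of p with g ^ n in [S].
    Then 1, g, ..., g ^ (n-1) is a basis of [R] over [S]: a relation of smallest degree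
    divides (X - g) ^ n, so it is a multiple of some (X - g) ^ m with m < n, and one of
    its coefficients shows that a smaller p-th power of g is a quotient of elements
    of [S]. Such a quotient lies in [S], because [S] contains the p-th roots in its
    fraction field of its own elements ([frob_free_root], [powers_basis]). For
    x^2 + y^3 + z^7 in characteristic 2, 3 or 7 the variable with exponent p
    generates the quotient over the polynomial ring in the two others, where its p-th
    power lies ([FFRT_hypersurface]).

    It remains to see that [S] is free over Frobenius. For polynomials a basis is
    written down from one of [k] over [k ^ p] ([polynomial_frob_free]). For a regular
    local ring of dimension d with residue field of degree t over its p-th powers, the
    theorem is due to Kunz ([kunz_regular_local]). By Nakayama's lemma, p ^ d * t
    elements span [S] over its p-th powers, namely products of the monomials with
    exponents less than p in the d generators of the maximal ideal with lifts of a
    basis of the residue field. On the other hand there are as many elements that are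
    independent over the p-th powers, so that the spanning family is a basis.
    Independent families are lifted down a prime chain of length d, starting with t
    elements at the maximal ideal; every step multiplies their number by p
    ([indep_growth]). Since no longer chain exists, consecutive primes P < Q of the
    chain are adjacent, so the localization of S / P at Q is one-dimensional, and the
    step is a comparison of lengths: if x lies in Q but not in P, then the quotient by
    x ^ p, as a module over p-th powers, has length at least p * t * l, where t is the
    number of independent elements at Q and l the length of the quotient by x, whereas a
    module of rank r contributes at most r * l. *)

(** * Lengths of saturated modules *)

Section SubsetOrder.
Variable T : Type.
Implicit Types X Y Z : T -> Prop.

Definition sle X Y := forall x, X x -> Y x.

Definition full : T -> Prop := fun=> True.

Lemma sle_refl X : sle X X. Proof. by []. Qed.

Lemma sle_trans Y X Z : sle X Y -> sle Y Z -> sle X Z.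
Proof. by move=> XY YZ x /XY/YZ. Qed.

Lemma sle_full X : sle X full. Proof. by []. Qed.
End SubsetOrder.
Arguments full {T}.
#[local] Hint Resolve sle_refl sle_full : core.

Definition mult_set (S : comNzRingType) (W : S -> Prop) :=
  W 1 /\ forall s t, W s -> W t -> W (s * t).

Section Saturated.
Variables (S : comNzRingType) (W : S -> Prop).
Hypothesis mW : mult_set W.
Implicit Types (th : {rmorphism S -> S}) (X Y Z J B : S -> Prop).

Definition submod th J :=
  [/\ J 0, (forall x y, J x -> J y -> J (x + y)) &
      forall a x, J x -> J (th a * x)].

(** Modules over the localization of [S] at [W], and their quotients, are handled
    inside [S] as submodules stable under division by [W]. The scalar s acts on [S] as
    multiplication by [th s]: with the identity for [th] the modules are ideals, with
    Frobenius they are modules over the p-th powers. *)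
Definition saturated th J := forall w x, W w -> J (th w * x) -> J x.

Definition satmod th J := submod th J /\ saturated th J.

(** The saturation of the sum of [X] and [Y], that is, their sum after localization. *)
Definition ssum th X Y : S -> Prop := fun z =>
  exists w x y, [/\ W w, X x, Y y & th w * z = x + y].

Definition line th (c : S) : S -> Prop := fun z => exists a, z = th a * c.

Lemma submod0 th J : submod th J -> J 0. Proof. by case. Qed.

Lemma submodN th J x : submod th J -> J x -> J (- x).
Proof. by case=> _ _ JM Jx; rewrite -mulN1r -(rmorphN1 th); apply: JM. Qed.

Lemma submodB th J x y : submod th J -> J x -> J y -> J (x - y).
Proof. by move=> sJ Jx Jy; case: (sJ) => _ JD _; apply: JD => //; apply: submodN sJ _. Qed.

Lemma line_submod th c : submod th (line th c).
Proof.
split; first by exists 0; rewrite rmorph0 mul0r.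
  by move=> x y [a ->] [b ->]; exists (a + b); rewrite rmorphD mulrDl.
by move=> a x [b ->]; exists (a * b); rewrite rmorphM mulrA.
Qed.

Lemma ssum_satmod th X Y : submod th X -> submod th Y -> satmod th (ssum th X Y).
Proof.
case=> X0 XD XM [Y0 YD YM]; split; first split.
- exists 1, 0, 0; split=> //; first exact: mW.1.
  by rewrite mulr0 addr0.
- move=> z z' [w [x [y [Ww Xx Yy e]]]] [w' [x' [y' [Ww' Xx' Yy' e']]]].
  exists (w * w'), (th w' * x + th w * x'), (th w' * y + th w * y'); split.
  + exact: mW.2.
  + by apply: XD; apply: XM.
  + by apply: YD; apply: YM.
  + have -> : th (w * w') * (z + z') = th w' * (th w * z) + th w * (th w' * z').
      by rewrite rmorphM; ring.
    by rewrite e e'; ring.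
- move=> a z [w [x [y [Ww Xx Yy e]]]].
  exists w, (th a * x), (th a * y); split; [done | exact: XM | exact: YM |].
  by rewrite mulrCA e mulrDr.
- move=> v z Wv [w [x [y [Ww Xx Yy e]]]].
  by exists (w * v), x, y; split=> //; [exact: mW.2 | rewrite rmorphM -mulrA].
Qed.

Lemma sle_ssuml th X Y : Y 0 -> sle X (ssum th X Y).
Proof. by move=> Y0 x Xx; exists 1, x, 0; split=> //; [exact: mW.1 | rewrite rmorph1 mul1r addr0]. Qed.

Lemma sle_ssumr th X Y : X 0 -> sle Y (ssum th X Y).
Proof. by move=> X0 y Yy; exists 1, 0, y; split=> //; [exact: mW.1 | rewrite rmorph1 mul1r add0r]. Qed.

Arguments sle_ssuml {th X Y}.
Arguments sle_ssumr {th X Y}.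

Lemma ssum_mono th X Y X' Y' :
  sle X X' -> sle Y Y' -> sle (ssum th X Y) (ssum th X' Y').
Proof.
move=> XX' YY' z [w [x [y [Ww Xx Yy e]]]].
by exists w, x, y; split=> //; [exact: XX' | exact: YY'].
Qed.

Lemma ssum_min th X Y J : satmod th J -> sle X J -> sle Y J -> sle (ssum th X Y) J.
Proof.
case=> -[_ JD _] Jsat XJ YJ z [w [x [y [Ww Xx Yy e]]]].
by apply: (Jsat w) => //; rewrite e; apply: JD; [exact: XJ | exact: YJ].
Qed.

Lemma line_min th J c : submod th J -> J c -> sle (line th c) J.
Proof. by case=> _ _ JM Jc _ [a ->]; apply: JM. Qed.

Lemma line_self th c : line th c c.
Proof. by exists 1; rewrite rmorph1 mul1r. Qed.

Lemma capI_satmod th X Y :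
  satmod th X -> satmod th Y -> satmod th (fun x => X x /\ Y x).
Proof.
case=> -[X0 XD XM] Xs [[Y0 YD YM] Ys]; split; first split=> //.
- by move=> x y [Xx Yx] [Xy Yy]; split; [exact: XD | exact: YD].
- by move=> a x [Xx Yx]; split; [exact: XM | exact: YM].
- by move=> w x Ww [Xx Yx]; split; [exact: Xs Xx | exact: Ys Yx].
Qed.

(** There are [n] strict inclusions of saturated modules between [Y] and [X]; the ends
    [Y] and [X] themselves are arbitrary sets. *)
Fixpoint chain th n Y X : Prop :=
  if n is n'.+1 then
    exists Z, [/\ satmod th Z, sle Y Z, ~ sle Z Y & chain th n' Z X]
  else sle Y X.

Lemma chain_sle th n Y X : chain th n Y X -> sle Y X.
Proof.
elim: n Y => [|n IHn] Y //= [Z [_ YZ _ /IHn ZX]].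
exact: sle_trans YZ ZX.
Qed.

Lemma chain_widen th n Y X Y' X' :
  sle Y' Y -> sle X X' -> chain th n Y X -> chain th n Y' X'.
Proof.
elim: n Y Y' => [|n IHn] Y Y' Y'Y XX' /=.
  by move=> YX; apply: sle_trans XX'; apply: sle_trans YX.
case=> Z [sZ YZ nZY cZ]; exists Z; split=> //.
- exact: sle_trans YZ.
- by move=> ZY'; apply: nZY; apply: sle_trans Y'Y.
- exact: IHn cZ.
Qed.

Lemma chain_cat th m n Y B X :
  chain th m Y B -> chain th n B X -> chain th (m + n) Y X.
Proof.
elim: m Y => [|m IHm] Y /=; first by move=> YB; apply: chain_widen.
by case=> Z [sZ YZ nZY cZ] cX; exists Z; split=> //; apply: IHm.
Qed.

(** Strictness is only required for modules between [Y] and [X]; the two actions may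
    differ, which allows chains of submodules to be compared with chains of ideals. *)
Lemma chain_map th th' (f : (S -> Prop) -> S -> Prop) n Y X :
    (forall Z, satmod th Z -> sle Y Z -> sle Z X -> satmod th' (f Z)) ->
    (forall Z Z', sle Z Z' -> sle (f Z) (f Z')) ->
    (forall Z Z', satmod th Z -> satmod th Z' -> sle Y Z -> sle Z' X ->
       sle Z Z' -> sle (f Z') (f Z) -> sle Z' Z) ->
  satmod th Y -> chain th n Y X -> chain th' n (f Y) (f X).
Proof.
move=> fsat fmono fstrict sY cY.
suff: forall Z, sle Y Z -> satmod th Z -> chain th n Z X -> chain th' n (f Z) (f X).
  by apply.
elim: n {cY} => [|n IHn] Z YZ sZ /=; first exact: fmono.
case=> Z' [sZ' ZZ' nZ'Z cZ']; have Z'X := chain_sle cZ'.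
have YZ' := sle_trans YZ ZZ'.
exists (f Z'); split; [exact: fsat | exact: fmono | | exact: IHn].
by move=> /(fstrict _ _ sZ sZ' YZ Z'X ZZ') /nZ'Z.
Qed.

(** The modular law: a strict inclusion of [Y] in [Z] remains strict after intersection
    with [B] or after addition of [B]. *)
Lemma chain_cap_sum th B n Y X : satmod th B -> satmod th Y -> chain th n Y X ->
  exists i j, [/\ (n <= i + j)%N,
    chain th i (fun x => Y x /\ B x) (fun x => X x /\ B x) &
    chain th j (ssum th Y B) (ssum th X B)].
Proof.
move=> sB; elim: n Y => [|n IHn] Y sY /=.
  move=> YX; exists 0%N, 0%N; split=> //=; last exact: ssum_mono.
  by move=> x [/YX].
case=> Z [sZ YZ nZY /(IHn _ sZ)[i [j [le_n ci cj]]]].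
have capYZ : sle (fun x => Y x /\ B x) (fun x => Z x /\ B x) by move=> x [/YZ].
have sumYZ : sle (ssum th Y B) (ssum th Z B) by apply: ssum_mono.
have [capZY|ncap] := pselect (sle (fun x => Z x /\ B x) (fun x => Y x /\ B x)).
  exists i, j.+1; split; first by rewrite addnS.
    exact: chain_widen ci.
  exists (ssum th Z B); split=> //; first exact: ssum_satmod sZ.1 sB.1.
  move=> sumZY; apply: nZY => z Zz.
  have [w [y [b [Ww Yy Bb e]]]] := sumZY z (sle_ssuml (submod0 sB.1) z Zz).
  (* b is the difference of elements of Z, so it lies in the common part with B. *)
  have Zb : Z b.
    have -> : b = th w * z - y by rewrite e addrC addKr.
    by apply: submodB sZ.1 _ (YZ _ Yy); case: sZ => -[_ _ ZM] _; apply: ZM.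
  have [Yb _] := capZY b (conj Zb Bb).
  by apply: (sY.2 w) => //; rewrite e; case: sY => -[_ YD _] _; apply: YD.
exists i.+1, j; split; first by rewrite addSn.
  exists (fun x => Z x /\ B x); split=> //; exact: capI_satmod.
exact: chain_widen cj.
Qed.

Lemma chain_split th B n Y X :
    satmod th Y -> satmod th B -> satmod th X -> sle Y B -> sle B X ->
    chain th n Y X ->
  exists i j, [/\ (n <= i + j)%N, chain th i Y B & chain th j B X].
Proof.
move=> sY sB sX YB BX /(chain_cap_sum sB sY)[i [j [le_n ci cj]]].
exists i, j; split=> //.
  by apply: chain_widen ci => [x Yx|x []//]; split=> //; apply: YB.
apply: chain_widen cj; first exact: sle_ssumr (submod0 sY.1).
exact: ssum_min.
Qed.

Definition len_le th Y X n := forall k, chain th k Y X -> (k <= n)%N.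

Lemma len_le_widen th n n' Y X Y' X' :
  sle Y Y' -> sle X' X -> (n <= n')%N -> len_le th Y X n -> len_le th Y' X' n'.
Proof.
move=> YY' X'X nn' le_n k ck; apply: leq_trans nn'; apply: le_n.
exact: chain_widen ck.
Qed.

Lemma len_le_add th m n Y B X :
    satmod th Y -> satmod th B -> satmod th X -> sle Y B -> sle B X ->
  len_le th Y B m -> len_le th B X n -> len_le th Y X (m + n).
Proof.
move=> sY sB sX YB BX lem len k /(chain_split sY sB sX YB BX)[i [j [le_k ci cj]]].
by apply: leq_trans le_k _; apply: leq_add; [exact: lem | exact: len].
Qed.

(** A bounded length is replaced by the exact one, for which a chain exists. *)
Lemma len_attained th Y X n : sle Y X -> len_le th Y X n ->
  exists2 l, chain th l Y X & len_le th Y X l.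
Proof.
move=> YX le_n; pose a l := `[< chain th l Y X >].
have exa : exists l, a l by exists 0%N; apply/asboolP.
have uba l : a l -> (l <= n)%N by move/asboolP/le_n.
case: (ex_maxnP exa uba) => l /asboolP cl lmax; exists l => // k ck.
by apply: lmax; apply/asboolP.
Qed.

(** The ideal of the scalars that move [c] into [J]. *)
Definition colon th J (c : S) : S -> Prop := fun s => J (th s * c).

Lemma colon_satmod th J c : satmod th J -> satmod idfun (colon th J c).
Proof.
case=> -[J0 JD JM] Js; split; first split.
- by rewrite /colon rmorph0 mul0r.
- by move=> x y; rewrite /colon rmorphD mulrDl; apply: JD.
- by move=> a x; rewrite /colon /= rmorphM -mulrA; apply: JM.
- by move=> w x Ww; rewrite /colon /= rmorphM -mulrA; apply: Js.
Qed.

(** Between [Y] and [Y] plus one line the modules are determined by their colon ideals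
    at [c], as for a cyclic module. *)
Lemma len_le_line th Y c I l : satmod th Y -> sle I (colon th Y c) ->
  len_le idfun I full l -> len_le th Y (ssum th Y (line th c)) l.
Proof.
move=> sY IY leI k ck; apply: leI.
apply: (chain_widen (Y := colon th Y c)
          (X := colon th (ssum th Y (line th c)) c)) => //.
apply: (chain_map (f := fun J => colon th J c)) ck => //.
- by move=> Z sZ _ _; apply: colon_satmod.
- by move=> Z Z' ZZ' x; apply: ZZ'.
move=> Z Z' sZ sZ' YZ Z'X ZZ' fZ'Z z Z'z.
have [w [y [_ [Ww Yy [a ->] e]]]] := Z'X z Z'z.
have Zac : Z (th a * c).
  apply: fZ'Z; rewrite /colon.
  have -> : th a * c = th w * z - y by rewrite e addrC addKr.
  apply: submodB sZ'.1 _ (ZZ' _ (YZ _ Yy)); case: sZ' => -[_ _ Z'M] _.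
  exact: Z'M.
apply: (sZ.2 w) => //; rewrite e; case: sZ => -[_ ZD _] _.
by apply: ZD => //; apply: YZ.
Qed.

(** The saturated module generated by [Y] and [cs]. *)
Definition adjs th Y (cs : seq S) : S -> Prop :=
  foldr (fun c J => ssum th J (line th c)) Y cs.

Lemma adjs_satmod th Y cs : satmod th Y -> satmod th (adjs th Y cs).
Proof.
move=> sY; elim: cs => //= c cs IHcs.
by apply: ssum_satmod; [exact: IHcs.1 | exact: line_submod].
Qed.

Lemma adjs_submod th Y cs : submod th Y -> submod th (adjs th Y cs).
Proof.
move=> sY; elim: cs => //= c cs IHcs.
by have [] := ssum_satmod IHcs (line_submod th c).
Qed.

Lemma line0 th c : line th c 0. Proof. by case: (line_submod th c). Qed.

Lemma sle_adjs th Y cs : sle Y (adjs th Y cs).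
Proof.
elim: cs => //= c cs IHcs; apply: sle_trans IHcs _.
exact: sle_ssuml (line0 th c).
Qed.

Lemma adjs_mono th Y Y' cs : sle Y Y' -> sle (adjs th Y cs) (adjs th Y' cs).
Proof. by move=> YY'; elim: cs => //= c cs IHcs; apply: ssum_mono. Qed.

Lemma adjs_mem th Y cs c : submod th Y -> c \in cs -> adjs th Y cs c.
Proof.
move=> sY; elim: cs => //= b cs IHcs; rewrite inE => /orP[/eqP->|c_cs].
  by apply: sle_ssumr (line_self th b); case: (adjs_submod cs sY).
by apply: sle_ssuml (line0 th b) _ (IHcs c_cs).
Qed.

Lemma adjs_sum th Y cs (a : 'I_(size cs) -> S) : submod th Y ->
  adjs th Y cs (\sum_i th (a i) * cs`_i).
Proof.
move=> sY; have [J0 JD JM] := adjs_submod cs sY.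
elim/big_rec: _ => // i x _ Jx; apply: (JD) => //.
by apply: JM; apply: adjs_mem sY _; apply: mem_nth.
Qed.

Lemma adjs_min th Y cs J : satmod th J -> sle Y J -> (forall c, c \in cs -> J c) ->
  sle (adjs th Y cs) J.
Proof.
move=> sJ YJ; elim: cs => //= c cs IHcs csJ.
apply: ssum_min => //; last by apply: line_min sJ.1 _; apply: csJ (mem_head _ _).
by apply: IHcs => b b_cs; apply: csJ; rewrite inE b_cs orbT.
Qed.

(** A module with r generators that are annihilated by [I] has length at most r times
    that of the quotient by [I]. *)
Lemma len_le_adjs th Y cs I l : satmod th Y ->
    (forall c, c \in cs -> sle I (colon th Y c)) ->
  len_le idfun I full l -> len_le th Y (adjs th Y cs) (size cs * l).
Proof.
move=> sY IY leI; elim: cs IY => /= [|c cs IHcs] IY.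
  case=> // k [Z [_ YZ nZY /chain_sle ZY]]; case: (nZY ZY).
rewrite mulSn addnC; have sA := adjs_satmod cs sY.
apply: (len_le_add (B := adjs th Y cs)) => //.
- by apply: ssum_satmod; [exact: sA.1 | exact: line_submod].
- exact: sle_adjs.
- exact: sle_ssuml (line0 th c).
- by apply: IHcs => b b_cs; apply: IY; rewrite inE b_cs orbT.
apply: len_le_line leI => // s Is.
by apply: (@sle_adjs th Y cs); apply: IY Is; apply: mem_head.
Qed.
End Saturated.

Local Notation ideal I := (submod (idfun : {rmorphism _ -> _}) I).

Arguments sle_ssuml {S W} mW {th X Y}.
Arguments sle_ssumr {S W} mW {th X Y}.
Arguments sle_adjs {S W} mW {th Y} cs.

(** * Prime ideals and finite length *)

Section Noetherian.
Variable S : comNzRingType.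
Implicit Types (I J P Q : S -> Prop) (th : {rmorphism S -> S}).

Lemma ideal_idealr_closed I : ideal I -> ~ I 1 ->
  idealr_closed (fun x => `[< I x >] : bool).
Proof.
case=> I0 ID IM nI1; split; [exact/asboolP | exact/asboolPn |].
by move=> a x y /asboolP Ix /asboolP Iy; apply/asboolP; apply: ID => //; apply: IM.
Qed.

(** Otherwise choice yields a strictly increasing sequence of ideals, and the union
    has finitely many generators, which already lie in one of them. *)
Lemma noetherian_ind (Phi : (S -> Prop) -> Prop) : noetherian S ->
    (forall I, ideal I ->
       (forall J, ideal J -> sle I J -> ~ sle J I -> Phi J) -> Phi I) ->
  forall I, ideal I -> Phi I.
Proof.
move=> nS step I0 iI0; apply: contrapT => nPhi0.
pose bad I := ideal I /\ ~ Phi I.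
have next (I : {I | bad I}) :
    exists J : {I | bad I}, sle (sval I) (sval J) /\ ~ sle (sval J) (sval I).
  case: I => I [iI nPhiI] /=; apply: contrapT => nJ; apply: nPhiI; apply: step => //.
  move=> J iJ IJ nJI; apply: contrapT => nPhiJ; apply: nJ.
  by exists (exist _ J (conj iJ nPhiJ)).
have [f fP] := choice next.
have [u [uP uS]] : exists u : nat -> S -> Prop,
    (forall n, ideal (u n)) /\ forall n, sle (u n) (u n.+1) /\ ~ sle (u n.+1) (u n).
  exists (fun n => sval (iter n f (exist _ I0 (conj iI0 nPhi0)))); split=> n.
    by case: (iter _ _ _) => I [].
  exact: fP.
have u_le m n : (m <= n)%N -> sle (u m) (u n).
  elim: n => [|n IHn]; first by rewrite leqn0 => /eqP->.
  rewrite leq_eqVlt => /orP[/eqP->//|/IHn mn]; apply: sle_trans mn _.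
  by case: (uS n).
pose U x := exists n, u n x.
have iU : ideal U.
  split; first by exists 0%N; case: (uP 0%N).
    move=> x y [m mx] [n ny]; exists (maxn m n); case: (uP (maxn m n)) => _ uD _.
    by apply: uD; [apply: u_le mx; apply: leq_maxl | apply: u_le ny; apply: leq_maxr].
  by move=> a x [n nx]; exists n; case: (uP n) => _ _; apply.
suff [n Un] : exists n, sle U (u n).
  by have [_ []] := uS n; move=> x ux; apply: Un; exists n.+1.
have [[n un1]|nU1] := pselect (U 1).
  by exists n => x _; rewrite -(mulr1 x); case: (uP n) => _ _; apply.
have [k [g gP]] := nS _ (ideal_idealr_closed iU nU1).
have gU i : U (g i).
  apply/asboolP/gP; exists (fun j => (j == i)%:R).
  rewrite (bigD1 i) //= eqxx mul1r big1 ?addr0 // => j /negPf->.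
  by rewrite mul0r.
have [N NP] := choice gU.
have [M leM] : exists M, forall i, (N i <= M)%N.
  by exists (\max_i N i)%N => i; apply: leq_bigmax.
exists M => x /asboolP/gP[c ->]; have [J0 JD JM] := uP M.
by elim/big_ind: _ => // i _; apply: JM; apply: u_le (NP i).
Qed.

Definition prime_set P :=
  [/\ ideal P, ~ P 1 & forall x y, P (x * y) -> P x \/ P y].

Definition compl P : S -> Prop := fun x => ~ P x.

Lemma compl_mult P : prime_set P -> mult_set (compl P).
Proof. by case=> _ P1 PM; split=> // s t Ps Pt /PM[]. Qed.

Lemma prime_setX P x n : prime_set P -> P (x ^+ n) -> P x.
Proof.
case=> _ P1 PM; elim: n => [|n IHn]; first by rewrite expr0.
by rewrite exprS => /PM[].
Qed.

Lemma ideal_submod th I : ideal I -> submod th I.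
Proof. by case=> I0 ID IM; split=> // a x /(IM (th a)). Qed.

Lemma prime_satmod th P Q : (forall x, P (th x) -> P x) ->
  prime_set P -> sle P Q -> satmod (compl Q) th P.
Proof.
move=> thP [iP _ PM] PQ; split; first exact: ideal_submod.
by move=> w x Qw /PM[/thP/PQ|].
Qed.

Lemma colon_sub_prime Q Z y : satmod (compl Q) idfun Z -> ~ Z y ->
  sle (colon idfun Z y) Q.
Proof. by move=> sZ nZy s Zsy; apply: contrapT => /sZ.2/(_ Zsy). Qed.

(** No prime lies strictly between [P] and [Q]. *)
Definition adjacent P Q :=
  forall Z, prime_set Z -> sle P Z -> sle Z Q -> sle Z P \/ sle Q Z.

(** The localization of S / P at Q has no prime other than 0 and Q. Noetherian
    induction: if I is not prime, choose a * b in I with a and b outside I; the chains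
    above I split at I + (a), and those between I and I + (a) correspond to chains
    above the colon ideal of a, which contains b. *)
Lemma finite_length P Q I : noetherian S -> prime_set P -> prime_set Q ->
    sle P Q -> adjacent P Q ->
    satmod (compl Q) idfun I -> sle P I -> ~ sle I P ->
  exists l, len_le (compl Q) idfun I full l.
Proof.
move=> nS pP pQ PQ adj sI; have mQ := compl_mult pQ.
have iI : ideal I := sI.1; move: I iI sI; apply: noetherian_ind nS _ => I iI IH sI PI nIP.
have [I1|nI1] := pselect (I 1).
  exists 0%N => -[|k] //= [Z [_ _ nZI _]]; case: nZI => x _.
  by rewrite -(mulr1 x); case: iI => _ _; apply.
have IQ : sle I Q.
  move=> x Ix; apply: contrapT => nQx; apply: nI1; apply: (sI.2 x) => //.
  by rewrite mulr1.
have [Iprime|] := pselect (forall x y, I (x * y) -> I x \/ I y).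
  have [//|QI] := adj I (And3 iI nI1 Iprime) PI IQ.
  exists 1%N => -[|[|k]] //= [Z [sZ _ nZI [Z' [_ _ nZ'Z _]]]].
  have [z [Zz nIz]] : exists z, Z z /\ ~ I z.
    apply: contrapT => nz; apply: nZI => z Zz; apply: contrapT => nIz.
    by apply: nz; exists z.
  case: nZ'Z => x _; rewrite -(mulr1 x); case: (sZ.1) => _ _; apply.
  by apply: (sZ.2 z); [move=> /QI | rewrite mulr1].
move=> nIprime; have [a [b [Iab nIa nIb]]] : exists a b, [/\ I (a * b), ~ I a & ~ I b].
  apply: contrapT => nab; apply: nIprime => x y Ixy; apply: contrapT => /not_orP[nIx nIy].
  by apply: nab; exists x, y.
pose J1 := ssum (compl Q) idfun I (line idfun a).
pose J2 := colon idfun I a.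
have sJ1 : satmod (compl Q) idfun J1 := ssum_satmod mQ sI.1 (line_submod _ a).
have sJ2 : satmod (compl Q) idfun J2 := colon_satmod a sI.
have IJ1 : sle I J1 := sle_ssuml mQ (line0 _ a).
have IJ2 : sle I J2.
  by move=> x Ix; rewrite /J2 /colon /= mulrC; case: iI => _ _; apply.
have [l1 len1] : exists l, len_le (compl Q) idfun J1 full l.
  apply: (IH _ _ _ _ sJ1) => //; first exact: sJ1.1.
  - by move=> J1I; apply: nIa; apply: J1I; apply: sle_ssumr (line_self _ a) => //; case: iI.
  - exact: sle_trans IJ1.
  - by move=> J1P; apply: nIP; apply: sle_trans J1P.
have [l2 len2] : exists l, len_le (compl Q) idfun J2 full l.
  apply: (IH _ _ _ _ sJ2) => //; first exact: sJ2.1.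
  - by move=> J2I; apply: nIb; apply: J2I; rewrite /J2 /colon /= mulrC.
  - exact: sle_trans IJ2.
  - by move=> J2P; apply: nIP; apply: sle_trans J2P.
exists (l2 + l1)%N; apply: (len_le_add mQ sI sJ1) => //.
exact: len_le_line len2.
Qed.
End Noetherian.

(** * Growth of independent families along a chain of primes *)

(** [pFrobenius_aut] with its morphism structure, kept folded so that rewriting rules for
    morphisms apply to it. *)
Definition frob (S : comNzRingType) (p : nat) (charS : p \in [pchar S]) :
  {rmorphism S -> S} := pFrobenius_aut charS.

Lemma frobE (S : comNzRingType) (p : nat) (charS : p \in [pchar S]) x :
  frob charS x = x ^+ p.
Proof. by []. Qed.

Section Growth.
Variables (S : comNzRingType) (p : nat) (charS : p \in [pchar S]).
Implicit Types (P Q X Y Z : S -> Prop) (th : {rmorphism S -> S}).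

Notation Fr := (frob charS).

(** Linear independence over the p-th powers in the residue field at the prime [P]:
    none of the elements lies in the saturated span of its successors, where
    saturation means division by scalars outside [P]. *)
Fixpoint indep P (cs : seq S) : Prop :=
  if cs is c :: cs' then ~ adjs (compl P) Fr P cs' c /\ indep P cs' else True.

Lemma prime_setFr P x : prime_set P -> P (Fr x) -> P x.
Proof. by move=> pP; rewrite frobE; apply: prime_setX. Qed.

Lemma prime_satmod_Fr P Q : prime_set P -> sle P Q -> satmod (compl Q) Fr P.
Proof. by move=> pP; apply: prime_satmod => // x; apply: prime_setFr. Qed.

Lemma prime_satmod_id P Q : prime_set P -> sle P Q -> satmod (compl Q) idfun P.
Proof. by move=> pP; apply: prime_satmod. Qed.

Lemma satmod_idFr Q Z : prime_set Q -> satmod (compl Q) idfun Z ->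
  satmod (compl Q) Fr Z.
Proof.
move=> pQ [sZ Zs]; split; first exact: ideal_submod.
by move=> w x Qw; apply: Zs => /(prime_setFr pQ).
Qed.

(** As [Y] does not contain [y], its colon ideal at [y] lies in [Q]; so relations among
    the products b * y modulo [Y] give relations among the b modulo [Q]. *)
Lemma adjs_cancel Q Y y bs z : prime_set Q ->
    satmod (compl Q) idfun Y -> ~ Y y ->
  adjs (compl Q) Fr Y [seq b * y | b <- bs] (z * y) -> adjs (compl Q) Fr Q bs z.
Proof.
move=> pQ sY nYy; elim: bs z => [|b bs IHbs] z /=.
  exact: (colon_sub_prime sY nYy).
case=> w [u [_ [Qw Yu [a ->] e]]].
exists w, (Fr w * z - Fr a * b), (Fr a * b); split=> //; last 2 first.
- by exists a.
- by rewrite subrK.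
apply: IHbs; suff -> : (Fr w * z - Fr a * b) * y = u by [].
by rewrite mulrBl -mulrA e -mulrA addrK.
Qed.

(** Above the residue class of [y], elements that are independent in the residue field
    give a strict chain of modules over the p-th powers. *)
Lemma chain_indep Q Y y bs : prime_set Q ->
    satmod (compl Q) idfun Y -> ~ Y y -> indep Q bs ->
  chain (compl Q) Fr (size bs) Y (adjs (compl Q) Fr Y [seq b * y | b <- bs]).
Proof.
move=> pQ sY nYy; have mQ := compl_mult pQ; have sYF := satmod_idFr pQ sY.
elim: bs => [_|b bs IHbs [nb /IHbs cbs]]; first exact: sle_refl.
rewrite [size _]/= -addn1.
apply: chain_cat cbs _; have sA := adjs_satmod mQ [seq b * y | b <- bs] sYF.
have A0 := submod0 sA.1.
exists (ssum (compl Q) Fr (adjs (compl Q) Fr Y [seq b * y | b <- bs])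
          (line Fr (b * y))); split=> //.
- by apply: ssum_satmod sA.1 (line_submod _ _).
- exact: sle_ssuml (line0 _ _).
move=> /(_ (b * y) (sle_ssumr mQ A0 _ (line_self _ _))).
by move/(adjs_cancel pQ sY nYy).
Qed.

(** Each step of a chain of ideals refines to t = [size bs] steps over the p-th powers;
    this is the factor by which the length grows under Frobenius. *)
Lemma ideal_chain_Fr Q n Y X bs : prime_set Q -> indep Q bs ->
    satmod (compl Q) idfun Y -> chain (compl Q) idfun n Y X ->
  chain (compl Q) Fr (n * size bs) Y X.
Proof.
move=> pQ ibs; elim: n Y => [|n IHn] Y sY //= [Z [sZ YZ nZY cZ]].
rewrite mulSn; apply: (chain_cat _ (IHn Z sZ cZ)).
have [y [Zy nYy]] : exists y, Z y /\ ~ Y y.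
  apply: contrapT => ny; apply: nZY => y Zy; apply: contrapT => nYy.
  by apply: ny; exists y.
apply: chain_widen (chain_indep pQ sY nYy ibs) => //.
apply: adjs_min => //; first exact: satmod_idFr.
by move=> _ /mapP[b _ ->]; case: sZ.1 => _ _; apply.
Qed.

Definition scale (c : S) Z : S -> Prop := fun z => exists2 y, Z y & z = c * y.

Lemma scale_submod th c Z : submod th Z -> submod th (scale c Z).
Proof.
case=> Z0 ZD ZM; split; first by exists 0; rewrite ?mulr0.
  by move=> _ _ [x Zx ->] [y Zy ->]; exists (x + y); rewrite ?mulrDr //; apply: ZD.
by move=> a _ [x Zx ->]; exists (th a * x); rewrite 1?mulrCA //; apply: ZM.
Qed.

Lemma scale_mono c Z Z' : sle Z Z' -> sle (scale c Z) (scale c Z').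
Proof. by move=> ZZ' _ [y /ZZ' Z'y ->]; exists y. Qed.

(** Multiplication by [c] is injective modulo the prime [P]. *)
Lemma chain_scale th P Q c n Y X : prime_set P -> prime_set Q ->
    ~ P c -> satmod (compl Q) th P -> satmod (compl Q) th Y -> sle P Y ->
    chain (compl Q) th n Y X ->
  chain (compl Q) th n (ssum (compl Q) th P (scale c Y))
    (ssum (compl Q) th P (scale c X)).
Proof.
move=> pP pQ nPc sP sY PY; have mQ := compl_mult pQ.
apply: (chain_map (f := fun Z => ssum (compl Q) th P (scale c Z))) => //.
- by move=> Z sZ _ _; apply: ssum_satmod sP.1 (scale_submod _ sZ.1).
- by move=> Z Z' ZZ'; apply: ssum_mono => //; apply: scale_mono.
move=> Z Z' sZ sZ' YZ Z'X ZZ' fZ'Z z Z'z.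
have [|w [x [_ [Qw Px [z0 Zz0 ->] e]]]] := fZ'Z (c * z).
  by apply: sle_ssumr (submod0 sP.1) _ _ => //; exists z.
have : P (c * (th w * z - z0)).
  suff -> : c * (th w * z - z0) = x by [].
  by rewrite mulrBr mulrCA e addrK.
case: (pP) => _ _ PM /PM[//|/PY/YZ Zd].
apply: (sZ.2 w) => //; rewrite -(subrK z0 (th w * z)).
by case: sZ.1 => _ ZD _; apply: ZD.
Qed.

(** The quotients of successive powers of [x] all have the length of the quotient
    by [x]. *)
Lemma chain_powers P Q x l k : prime_set P -> prime_set Q -> sle P Q -> ~ P x ->
    chain (compl Q) idfun l (ssum (compl Q) idfun P (line idfun x)) full ->
  chain (compl Q) idfun (k * l) (ssum (compl Q) idfun P (line idfun (x ^+ k))) full.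
Proof.
move=> pP pQ PQ nPx cl; have mQ := compl_mult pQ.
have sP := prime_satmod_id pP PQ; have P0 := submod0 sP.1.
elim: k => [|k IHk] //; rewrite mulSn; apply: chain_cat IHk.
have sI : satmod (compl Q) idfun (ssum (compl Q) idfun P (line idfun x)).
  by apply: ssum_satmod sP.1 (line_submod _ _).
have nPxk : ~ P (x ^+ k) by move/(prime_setX pP).
apply: chain_widen (chain_scale pP pQ nPxk sP sI _ cl).
- apply: ssum_mono => // _ [a ->]; exists (a * x).
    by apply: sle_ssumr P0 _ _ => //; exists a.
  by rewrite exprSr /=; ring.
- by apply: ssum_mono => // _ [y _ ->]; exists y; rewrite /= mulrC.
- exact: sle_ssuml (line0 _ _).
Qed.

(** Extend an independent family until it has [n] elements or is maximal. *)
Lemma indep_dichotomy P n : (exists cs, size cs = n /\ indep P cs) \/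
  (exists2 cs, (size cs < n)%N & forall c, adjs (compl P) Fr P cs c).
Proof.
elim: n => [|n [[cs [scs ics]]|[cs lt_cs csP]]]; first by left; exists [::].
- have [[c nc]|all_c] := pselect (exists c, ~ adjs (compl P) Fr P cs c).
    by left; exists (c :: cs); rewrite /= scs.
  right; exists cs; first by rewrite scs.
  by move=> c; apply: contrapT => nc; apply: all_c; exists c.
- by right; exists cs => //; apply: ltnW.
Qed.

(** The factor [a] collects the denominators outside [P], which need not be
    invertible in the localization at [Q]. *)
Lemma adjs_denominator P Q cs y : prime_set P -> prime_set Q -> sle P Q ->
  adjs (compl P) Fr P cs y -> exists2 a, ~ P a & adjs (compl Q) Fr P cs (Fr a * y).
Proof.
move=> pP pQ PQ; have [mP mQ] := (compl_mult pP, compl_mult pQ).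
elim: cs y => [|c cs IHcs] y /=.
  by move=> Py; exists 1; [case: pP | rewrite rmorph1 mul1r].
case=> w [u [_ [Pw /IHcs[v Pv Av] [a ->] e]]].
exists (v * w); first exact: mP.2.
exists 1, (Fr v * u), (Fr (v * a) * c); split=> //; first exact: mQ.1.
  by exists (v * a).
by rewrite rmorph1 mul1r !rmorphM -!mulrA e mulrDr.
Qed.

Lemma common_denominator P Q cs (ys : seq S) : prime_set P -> prime_set Q -> sle P Q ->
    (forall y, adjs (compl P) Fr P cs y) ->
  exists2 a, ~ P a & forall y, y \in ys -> adjs (compl Q) Fr P cs (Fr a * y).
Proof.
move=> pP pQ PQ all_y; have [mP mQ] := (compl_mult pP, compl_mult pQ).
have [_ _ AM] := (adjs_satmod mQ cs (prime_satmod_Fr pP PQ)).1.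
elim: ys => [|y ys [a Pa aP]]; first by exists 1; [exact: mP.1 |].
have [b Pb Ab] := adjs_denominator pP pQ PQ (all_y y).
exists (a * b) => [|z]; first exact: mP.2.
rewrite inE => /orP[/eqP->|/aP Az]; first by rewrite rmorphM -mulrA; apply: AM.
have -> : Fr (a * b) * z = Fr b * (Fr a * z) by rewrite rmorphM; ring.
exact: AM.
Qed.

(** If a ^ p * y lies in [X], then [y] generates modulo [X] a quotient of the ring
    modulo a. *)
Lemma colon_line P Q X a y : prime_set P -> prime_set Q -> sle P X ->
    satmod (compl Q) Fr X -> X (Fr a * y) ->
  sle (ssum (compl Q) idfun P (line idfun a)) (colon Fr X y).
Proof.
move=> pP pQ PX sX Xay; have sC := colon_satmod y sX.
apply: ssum_min => //; last exact: line_min sC.1 _.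
move=> z Pz; apply: PX; rewrite frobE mulrC; case: pP => -[_ _ PM] _ _; apply: (PM).
have p_gt0 := prime_gt0 (pcharf_prime charS).
by rewrite -(prednK p_gt0) exprSr; apply: PM.
Qed.

(** Suppose that a maximal independent family [cs] at [P] had fewer than p * t elements,
    where t = [size bs]. Let [F] be its span and choose x in [Q] outside [P]. The
    quotient of [S] by [F] is a finitely generated torsion module, hence of finite
    length m, and multiplication by x ^ p maps it isomorphically onto the quotient of
    x ^ p S by x ^ p F, modulo [P]. Counting the length between x ^ p F and [S] through
    x ^ p S gives at least m + p * t * l, and counting it through [F] gives at most
    size cs * l + m, with l > 0 the length of the quotient by x. *)
Lemma indep_growth P Q ys bs : noetherian S ->
    prime_set P -> prime_set Q -> sle P Q -> ~ sle Q P -> adjacent P Q ->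
    (forall Y z, submod Fr Y -> adjs (compl Q) Fr Y ys z) -> indep Q bs ->
  exists2 cs, size cs = (p * size bs)%N & indep P cs.
Proof.
move=> nS pP pQ PQ nQP adj ysP ibs; have mQ := compl_mult pQ.
have [[cs [scs ics]]|[cs lt_cs csP]] := indep_dichotomy P (p * size bs).
  by exists cs.
have [sPF sP] := (prime_satmod_Fr pP PQ, prime_satmod_id pP PQ).
have P0 := submod0 sP.1; have [_ _ PM] := sP.1.
have [x [Qx nPx]] : exists x, Q x /\ ~ P x.
  apply: contrapT => nx; apply: nQP => x Qx; apply: contrapT => nPx.
  by apply: nx; exists x.
have finlen y : ~ P y ->
    exists l, len_le (compl Q) idfun (ssum (compl Q) idfun P (line idfun y)) full l.
  move=> nPy; apply: finite_length adj _ _ _ => //.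
  - exact: ssum_satmod sP.1 (line_submod _ _).
  - exact: sle_ssuml (line0 _ _).
  - by apply: contra_not nPy => IP; apply: IP; apply: sle_ssumr (line_self _ _).
pose F := adjs (compl Q) Fr P cs.
have sF : satmod (compl Q) Fr F := adjs_satmod mQ cs sPF.
have PF : sle P F := sle_adjs mQ cs.
pose xS := ssum (compl Q) idfun P (line idfun x).
have [l cl lenl] : exists2 l, chain (compl Q) idfun l xS full &
    len_le (compl Q) idfun xS full l.
  by have [l0 /len_attained[]// l] := finlen x nPx; exists l.
have l_gt0 : (0 < l)%N.
  apply: (lenl 1%N); exists full; split=> // full_xS.
  suff xSQ : sle xS Q by case: pQ => _ nQ1 _; apply/nQ1/xSQ/full_xS.
  apply: ssum_min => //; first exact: prime_satmod_id.
    by apply: line_min Qx; case: pQ => -[].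
have [a nPa aP] := common_denominator ys pP pQ PQ csP.
(* A common denominator a moves all generators of S into F, so S / F has finite length. *)
have [m cm lenm] : exists2 m, chain (compl Q) Fr m F full &
    len_le (compl Q) Fr F full m.
  have [la lenla] := finlen a nPa.
  have lenF : len_le (compl Q) Fr F (adjs (compl Q) Fr F ys) (size ys * la).
    apply: len_le_adjs lenla => // y y_ys.
    by apply: colon_line => //; apply: aP.
  apply: (len_attained (n := (size ys * la)%N)) => //.
  by apply: len_le_widen lenF => // z _; apply: ysP; apply: sF.1.
pose xF := ssum (compl Q) Fr P (scale (x ^+ p) F).
pose xM := ssum (compl Q) Fr P (scale (x ^+ p) full).
have nPxp : ~ P (x ^+ p) by move/(prime_setX pP).
have sxF : satmod (compl Q) Fr xF by apply: ssum_satmod sPF.1 (scale_submod _ sF.1).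
have PxF : sle P xF by apply: sle_ssuml (submod0 (scale_submod _ sF.1)).
have xF_F : sle xF F.
  apply: ssum_min => // _ [y Fy ->]; rewrite -frobE.
  by case: sF.1 => _ _; apply.
(* The route through x ^ p S. *)
have c_lower : chain (compl Q) Fr (m + p * l * size bs) xF full.
  apply: (chain_cat (B := xM)); first exact: chain_scale cm.
  have sxp : satmod (compl Q) idfun (ssum (compl Q) idfun P (line idfun (x ^+ p))).
    by apply: ssum_satmod sP.1 (line_submod _ _).
  apply: chain_widen (ideal_chain_Fr pQ ibs sxp (chain_powers p pP pQ PQ nPx cl)) => //.
  apply: ssum_min; first exact: satmod_idFr.
    exact: sle_ssuml (line0 _ _).
  move=> _ [y _ ->]; apply: sle_ssumr P0 _ _ => //.
  by exists y; rewrite /= mulrC.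
(* The route through F. *)
have c_upper : len_le (compl Q) Fr xF full (size cs * l + m).
  apply: (len_le_add mQ sxF sF) => //.
  apply: (len_le_widen (X := adjs (compl Q) Fr xF cs) (Y := xF)
            (n := (size cs * l)%N)) => //.
    exact: adjs_mono.
  apply: len_le_adjs lenl => // c c_cs; apply: colon_line => //.
  apply: sle_ssumr P0 _ _ => //; exists c => //.
  by apply: adjs_mem => //; apply: sPF.1.
have := c_upper _ c_lower.
rewrite addnC leq_add2r -mulnA mulnCA mulnC leq_pmul2r // leqNgt.
by rewrite lt_cs.
Qed.
End Growth.

(** * Prime chains and maximal ideals of a local ring *)

Section PrimeChains.
Variable S : comNzRingType.
Implicit Types (I P Q Y Z : S -> Prop).

Lemma ideal_idfun (I : {pred S}) : idealr_closed I -> ideal (fun x => x \in I).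
Proof.
case=> I0 _ IM; split=> // [x y Ix Iy|a x Ix].
  by rewrite -(mul1r x); apply: IM.
by rewrite -[idfun a * x]addr0; apply: IM.
Qed.

Lemma prime_idealP (P : {pred S}) : prime_ideal P -> prime_set (fun x => x \in P).
Proof.
case=> iP PM; split; [exact: ideal_idfun | by case: iP => _ /negP |].
by move=> x y /PM/orP.
Qed.

Lemma prime_ideal_set P : prime_set P -> prime_ideal (fun x => `[< P x >] : bool).
Proof.
case=> iP P1 PM; split; first exact: ideal_idealr_closed.
by move=> x y /asboolP/PM[]Pz; apply/orP; [left | right]; apply/asboolP.
Qed.

(** There is a strict chain of [n] inclusions of primes that starts at [Y]. *)
Fixpoint pchain n Y : Prop :=
  if n is n'.+1 then
    exists Z, [/\ prime_set Z, sle Y Z, ~ sle Z Y & pchain n' Z]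
  else True.

Lemma pchain_of_prime_chain d : prime_chain S d ->
  exists2 Y, prime_set Y & pchain d Y.
Proof.
case=> P [Pprime Plt].
suff H k n : (k + n = d)%N -> pchain n (fun x => x \in P (inord k)).
  by exists (fun x => x \in P (inord 0)); [exact: prime_idealP | exact: (H 0%N)].
elim: n k => //= n IHn k kn; exists (fun x => x \in P (inord k.+1)).
have lt_kd : (k < d)%N by rewrite -kn addnS ltnS leq_addr.
have [] := Plt (inord k) (inord k.+1); first by rewrite !inordK // ltnS ltnW.
split=> //; first exact: prime_idealP.
by apply: IHn; rewrite addSnnS.
Qed.

Lemma prime_chain_of_pchain d Y : prime_set Y -> pchain d Y -> prime_chain S d.
Proof.
move=> pY cY.
suff [F [F0 [Fp Flt]]] : exists F : nat -> S -> Prop, F 0%N = Y /\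
    (forall i, prime_set (F i)) /\
    forall i j, (i < j)%N -> (j <= d)%N -> sle (F i) (F j) /\ ~ sle (F j) (F i).
  exists (fun i : 'I_d.+1 => fun x => `[< F i x >] : bool); split.
    by move=> i; apply: prime_ideal_set.
  move=> i j /Flt[|le_ij nle_ij]; first by rewrite -ltnS.
  split=> [x /asboolP Fx|le_ji]; first by apply/asboolP; apply: le_ij.
  by apply: nle_ij => x Fx; apply/asboolP/le_ji/asboolP.
elim: d Y pY cY => [|d IHd] Y pY /=.
  by exists (fun=> Y); do 2!split=> //; move=> i [|j].
case=> Z [pZ YZ nZY /(IHd Z pZ)[F [F0 [Fp Flt]]]].
have ZF j : (j <= d)%N -> sle Z (F j).
  by case: j => [|j] le_jd; [rewrite F0 | rewrite -F0; case: (Flt 0%N j.+1)].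
exists (fun i => if i is i'.+1 then F i' else Y); split=> //; split; first by case.
move=> [|i] [|j] //; last by move=> ij jd; apply: Flt.
rewrite ltnS => _ /ZF ZFj; split; first exact: sle_trans ZFj.
by move=> FjY; apply: nZY; apply: sle_trans FjY.
Qed.

Variables (p : nat) (charS : p \in [pchar S]).

(** Here [Y] starts a chain of length [n] and none of length [n + 1]. The next prime of
    the chain then has the same property with [n - 1], and it is adjacent to [Y]; for
    [n = 0] the prime [Y] is the largest one. *)
Lemma indep_primes Q (ys bs : seq S) n Y : noetherian S -> prime_set Q ->
    (forall P, prime_set P -> sle P Q) ->
    (forall P Z z, prime_set P -> submod (frob charS) Z ->
       adjs (compl P) (frob charS) Z ys z) ->
    indep charS Q bs ->
    prime_set Y -> pchain n Y -> ~ pchain n.+1 Y ->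
  exists2 cs, size cs = (p ^ n * size bs)%N & indep charS Y cs.
Proof.
move=> nS pQ leQ ysP ibs; elim: n Y => [|n IHn] Y pY.
  move=> _ nY; suff -> : Y = Q by exists bs; rewrite // mul1n.
  apply/funext => x; apply/propext; split; first exact: leQ.
  move: x; apply: contrapT => nQY; apply: nY; exists Q; split=> //; exact: leQ.
case=> Z [pZ YZ nZY cZ] maxY.
have [|cs scs ics] := IHn Z pZ cZ.
  by move=> cZ'; apply: maxY; exists Z.
rewrite expnS -mulnA -scs; apply: (indep_growth (Q := Z) (ys := ys)) => //.
- move=> V pV YV VZ; apply: contrapT => /not_orP[nVY nZV]; apply: maxY.
  by exists V; split=> //; exists Z.
- by move=> X z; apply: ysP.
Qed.
End PrimeChains.

Section LocalRing.
Variables (S : comNzRingType) (m : {pred S}).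
Hypotheses (nS : noetherian S) (locS : local_with m).
Implicit Types (I P Q Y Z : S -> Prop).

Let M : S -> Prop := fun x => x \in m.

Lemma local_ideal : ideal M.
Proof. by case: locS => -[im _] _; apply: ideal_idfun. Qed.

Lemma local_proper : ~ M 1.
Proof. by case: locS => -[[_ /negP]]. Qed.

Lemma ideal_le_maximal I : ideal I -> ~ I 1 -> sle I M.
Proof.
suff H : forall I, ideal I -> ~ I 1 -> exists m', maximal_ideal m' /\
    forall x, I x -> x \in m'.
  move=> iI nI1; have [m' [mm' Im']] := H I iI nI1.
  by move=> x /Im'; case: locS => _ /(_ _ mm') ->.
move=> {I}; apply: noetherian_ind => // I iI IH nI1.
have [[J [iJ IJ nJI nJ1]]|nJ] :=
    pselect (exists J, [/\ ideal J, sle I J, ~ sle J I & ~ J 1]).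
  have [m' [mm' Jm']] := IH J iJ IJ nJI nJ1.
  by exists m'; split=> // x /IJ/Jm'.
exists (fun x => `[< I x >] : bool); split; last by move=> x /asboolP.
split; first exact: ideal_idealr_closed.
move=> J iJ IJ x Jx; apply/asboolP; move: x Jx; apply: contrapT => nJI; apply: nJ.
exists (fun x => x \in J); split=> //; first exact: ideal_idfun.
  by move=> x Ix; apply: IJ; apply/asboolP.
by case: iJ => _ /negP.
Qed.

Lemma local_unit x : ~ M x -> exists y, x * y = 1.
Proof.
move=> nMx; have [[a ae]|nl] := pselect (line idfun x 1).
  by exists a; rewrite ae mulrC.
case: nMx; apply: (ideal_le_maximal (line_submod _ x) nl); exact: line_self.
Qed.

Lemma local_prime : prime_set M.
Proof.
split; [exact: local_ideal | exact: local_proper |].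
move=> x y Mxy; apply: contrapT => /not_orP[/local_unit[x' xx'] /local_unit[y' yy']].
apply: local_proper; have -> : 1 = x' * y' * (x * y).
  by rewrite -[LHS]mulr1 -{1}xx' -yy'; ring.
by case: local_ideal => _ _; apply.
Qed.

Lemma prime_le_maximal P : prime_set P -> sle P M.
Proof. by case=> iP P1 _; apply: ideal_le_maximal. Qed.
End LocalRing.

(** * Spanning families and bases over Frobenius *)

Definition spanning (A B : comNzRingType) (f : {rmorphism A -> B}) (I : finType)
    (b : I -> B) := forall y, exists t : I -> A, y = \sum_i f (t i) * b i.

Definition independent (A B : comNzRingType) (f : {rmorphism A -> B}) (I : finType)
    (b : I -> B) :=
  forall t : I -> A, \sum_i f (t i) * b i = 0 -> forall i, t i = 0.

(** A basis of [B] over [A], where [A] acts on [B] through [f]. *)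
Definition basis_over (A B : comNzRingType) (f : {rmorphism A -> B}) (I : finType)
    (b : I -> B) := spanning f b /\ independent f b.

(** Let C express the independent family through the spanning one. Its determinant is
    not 0, since a vector killed by C is a relation of the independent family; and a
    relation t of the spanning family gives the relation t * adj C of the independent
    one. *)
Lemma spanning_independent (A : idomainType) (B : comNzRingType)
    (f : {rmorphism A -> B}) n (z c : 'I_n -> B) :
  spanning f z -> independent f c -> independent f z.
Proof.
move=> zspan cind t tz0; have [a aP] := choice (fun j => zspan (c j)).
pose C := \matrix_(j, i) a j i.
have sumC (v : 'rV[A]_n) :
    \sum_j f (v 0 j) * c j = \sum_i f ((v *m C) 0 i) * z i.
  transitivity (\sum_j \sum_i f (v 0 j * C j i) * z i).
    apply: eq_bigr => j _; rewrite [in LHS]aP mulr_sumr; apply: eq_bigr => i _.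
    by rewrite mxE rmorphM mulrA.
  rewrite exchange_big; apply: eq_bigr => i _.
  by rewrite mxE rmorph_sum mulr_suml.
have detC : \det C != 0.
  apply/det0P => -[v /negP v0 vC]; apply: v0; apply/eqP/rowP => j; rewrite mxE.
  apply: (cind (fun j => v 0 j)); rewrite sumC vC big1 // => i _.
  by rewrite mxE rmorph0 mul0r.
pose u := (\row_i t i) *m \adj C.
have uC : u *m C = \det C *: \row_i t i.
  by rewrite -mulmxA mul_adj_mx mul_mx_scalar.
have u0 : u = 0.
  apply/rowP => j; rewrite [RHS]mxE; apply: (cind (fun j => u 0 j)).
  rewrite sumC uC; under eq_bigr => i _ do rewrite !mxE rmorphM -mulrA.
  by rewrite -mulr_sumr tz0 mulr0.
move=> i; have /rowP/(_ i) := uC; rewrite u0 mul0mx !mxE => /esym/eqP.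
by rewrite mulf_eq0 (negPf detC) => /eqP.
Qed.

Section Spans.
Variables (S : comNzRingType) (p : nat) (charS : p \in [pchar S]).
Implicit Types (I Q N Y Z M : S -> Prop) (bs cs xs ys zs : seq S).

Notation Fr := (frob charS).
Definition zeroset : S -> Prop := fun x => x = 0.

Lemma zeroset_submod th : submod th zeroset.
Proof.
split=> //; first by move=> x y -> ->; exact: addr0.
by move=> a x ->; exact: mulr0.
Qed.

(** With this multiplicative set saturation is void, and [adjs] is the plain span. *)
Definition oneset : S -> Prop := fun x => x = 1.

Lemma mult_one : mult_set oneset.
Proof. by split=> // s t -> ->; exact: mulr1. Qed.

Notation plus := (ssum oneset).
Notation spans := (adjs oneset).

Lemma submod_satmod th Z : submod th Z -> satmod oneset th Z.
Proof. by move=> sZ; split=> // w x ->; rewrite rmorph1 mul1r. Qed.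

Lemma spans_spanning cs : (forall z, spans Fr zeroset cs z) ->
  spanning Fr (fun i : 'I_(size cs) => cs`_i).
Proof.
move=> cspan z; pose J z := exists t : 'I_(size cs) -> S, z = \sum_i Fr (t i) * cs`_i.
suff : sle (spans Fr zeroset cs) J by apply.
apply: adjs_min.
- apply: submod_satmod; split.
  + by exists (fun=> 0); rewrite big1 // => i _; rewrite rmorph0 mul0r.
  + move=> _ _ [t ->] [u ->]; exists (fun i => t i + u i); rewrite -big_split.
    by apply: eq_bigr => i _; rewrite rmorphD mulrDl.
  + move=> a _ [t ->]; exists (fun i => a * t i); rewrite mulr_sumr.
    by apply: eq_bigr => i _; rewrite rmorphM mulrA.
- move=> _ ->; exists (fun=> 0); rewrite big1 // => i _.
  by rewrite rmorph0 mul0r.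
move=> c /(nthP 0)[i lti <-]; exists (fun j => (j == Ordinal lti)%:R).
rewrite (bigD1 (Ordinal lti)) //= eqxx rmorph1 mul1r big1 ?addr0 // => j /negPf->.
by rewrite rmorph0 mul0r.
Qed.

Lemma spanning_spans W n (g : 'I_n -> S) Y z : mult_set W ->
  spanning Fr g -> submod Fr Y -> adjs W Fr Y [seq g i | i <- enum 'I_n] z.
Proof.
move=> mW gspan sY; have [t ->] := gspan z.
have [A0 AD AM] := adjs_submod mW [seq g i | i <- enum 'I_n] sY.
elim/big_ind: _ => // i _; apply: AM; apply: adjs_mem => //.
by apply: map_f; rewrite mem_enum.
Qed.

(** Discard from [ys] each element that depends on those kept. *)
Lemma indep_extract Q ys : prime_set Q ->
  exists2 bs, indep charS Q bs & forall y, y \in ys -> adjs (compl Q) Fr Q bs y.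
Proof.
move=> pQ; have mQ := compl_mult pQ.
have sQ : satmod (compl Q) Fr Q by apply: prime_satmod_Fr.
elim: ys => [|y ys [bs ibs bsP]]; first by exists [::].
have [Ay|nAy] := pselect (adjs (compl Q) Fr Q bs y).
  by exists bs => // z; rewrite inE => /orP[/eqP->|/bsP].
exists (y :: bs) => // z; rewrite inE => /orP[/eqP->|/bsP Az].
  by apply: adjs_mem => //; [exact: sQ.1 | exact: mem_head].
exact: sle_ssuml (line0 _ _) _ Az.
Qed.

Lemma adjs_units Q Y bs : mult_set (compl Q) -> submod Fr Y ->
    (forall x, ~ Q x -> exists y, x * y = 1) ->
  sle (adjs (compl Q) Fr Y bs) (spans Fr Y bs).
Proof.
move=> mQ sY unitQ; have sA := adjs_submod mult_one bs sY.
apply: adjs_min; last by move=> c c_bs; apply: (adjs_mem mult_one sY c_bs).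
  split=> // w x /unitQ[v vw] Ax; have <- : Fr v * (Fr w * x) = x.
    by rewrite mulrA -rmorphM mulrC [v * w]mulrC vw rmorph1 mulr1.
  by case: sA => _ _; apply.
exact: (sle_adjs mult_one bs).
Qed.

Lemma indep_independent (cs : seq S) : prime_set zeroset -> indep charS zeroset cs ->
  independent Fr (fun i : 'I_(size cs) => cs`_i).
Proof.
move=> p0; have m0 := compl_mult p0.
elim: cs => [|c cs IHcs]; first by move=> _ t _ [].
case=> nc ics t; rewrite big_ord_recl /= => tc0.
have t0 : t ord0 = 0.
  apply: contrapT => nt0; apply: nc.
  have s0 : satmod (compl zeroset) Fr zeroset by apply: prime_satmod_Fr.
  apply: (adjs_satmod m0 cs s0).2 nt0 _.
  move/eqP: tc0; rewrite addr_eq0 => /eqP->.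
  apply: submodN (adjs_submod m0 cs s0.1) _.
  by apply: adjs_sum => //; apply: s0.1.
move: tc0; rewrite t0 rmorph0 mul0r add0r => tc0 i.
case: (unliftP ord0 i) => [j|] -> //.
by apply: (IHcs ics (fun j => t (lift ord0 j))).
Qed.

(** If [bs] spans modulo I + (x), then iterating z = (combination) + i + x * y yields
    every z up to x ^ p * y, with coefficients on the products x ^ j * b for j < p. *)
Lemma spans_power I x bs : ideal I ->
    (forall z, spans Fr (plus idfun I (line idfun x)) bs z) ->
  forall z, spans Fr (plus idfun I (line idfun (x ^+ p)))
              [seq x ^+ j * b | j <- iota 0 p, b <- bs] z.
Proof.
move=> iI bspan; set J := plus _ _ _; set L := [seq _ | j <- _, b <- _].
have iJ : ideal J.
  by have [] := ssum_satmod mult_one iI (line_submod idfun (x ^+ p)).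
have IJ : sle I J := sle_ssuml mult_one (line0 _ _).
have sN : submod Fr (spans Fr J L) := adjs_submod mult_one L (ideal_submod Fr iJ).
have JN : sle J (spans Fr J L) := sle_adjs mult_one L.
suff H j : (j <= p)%N ->
    forall z, exists u y, spans Fr J L u /\ z = u + x ^+ j * y.
  move=> z; have [u [y [Nu ->]]] := H p (leqnn p) z.
  case: (sN) => _ ND _; apply: ND => //; apply: JN.
  by apply: sle_ssumr (submod0 iI) _ _ => //; [exact: mult_one | exists y; rewrite mulrC].
elim: j => [|j IHj] lt_jp z.
  by exists 0, z; rewrite add0r mul1r; split=> //; apply: submod0 sN.
have [u [y [Nu ->]]] := IHj (ltnW lt_jp) z.
pose D y := exists u y', spans Fr J L u /\ x ^+ j * y = u + x ^+ j.+1 * y'.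
suff /(_ y (bspan y)) [v [y' [Nv ->]]] :
    sle (spans Fr (plus idfun I (line idfun x)) bs) D.
  by exists (u + v), y'; rewrite addrA; split=> //; case: sN => _ ND _; apply: ND.
case: (sN) => N0 ND NM; apply: adjs_min.
- apply: submod_satmod; split.
  + by exists 0, 0; rewrite !mulr0 addr0.
  + move=> a b [ua [ya [Nua ea]]] [ub [yb [Nub eb]]].
    exists (ua + ub), (ya + yb); split; first exact: ND.
    by rewrite mulrDr ea eb; ring.
  + move=> a b [ub [yb [Nub eb]]]; exists (Fr a * ub), (Fr a * yb).
    by split; [exact: NM | rewrite mulrCA eb; ring].
- move=> a [w [i [_ [-> Ii [c ->]]]]]; rewrite rmorph1 mul1r => ->.
  exists (x ^+ j * i), c; split; last by rewrite exprSr /=; ring.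
  by apply/JN/IJ; case: iI => _ _; apply.
- move=> b b_bs; exists (x ^+ j * b), 0; rewrite mulr0 addr0; split=> //.
  apply: (adjs_mem mult_one (ideal_submod Fr iJ) _).
  by apply: allpairs_f => //; rewrite mem_iota.
Qed.

Lemma spans_plus_line (Y : S -> Prop) x xs z : ideal Y ->
  spans idfun (plus idfun Y (line idfun x)) xs z <->
  spans idfun Y (x :: xs) z.
Proof.
move=> iY; have sL := line_submod (idfun : {rmorphism S -> S}) x.
have iYx : ideal (plus idfun Y (line idfun x)).
  by have [] := ssum_satmod mult_one iY sL.
have sA : submod idfun (spans idfun Y xs) by apply: (adjs_submod mult_one _ iY).
split; move: z.
  apply: adjs_min.
  - exact: (ssum_satmod mult_one sA sL).
  - by apply: ssum_mono => //; apply: (sle_adjs mult_one xs).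
  - move=> c c_xs; apply: (sle_ssuml mult_one (line0 _ _) _ _).
    exact: (adjs_mem mult_one iY c_xs).
apply: ssum_min; first by apply: (adjs_satmod mult_one _ (submod_satmod iYx)).
  by apply: adjs_mono; apply: (sle_ssuml mult_one (line0 _ _)).
apply: line_min; first exact: (adjs_submod mult_one _ iYx).
apply: (sle_adjs mult_one xs _ _).
exact: (sle_ssumr mult_one (submod0 iY) _ (line_self _ _)).
Qed.

Lemma spans_powers Y xs bs : ideal Y ->
    (forall z, spans Fr (spans idfun Y xs) bs z) ->
  exists2 zs, size zs = (p ^ size xs * size bs)%N &
    forall z, spans Fr (spans idfun Y [seq x ^+ p | x <- xs]) zs z.
Proof.
elim: xs Y bs => [|x xs IHxs] Y bs iY bspan; first by exists bs; rewrite // mul1n.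
have iA : ideal (spans idfun Y xs) by apply: (adjs_submod mult_one _ iY).
have iYxp : ideal (plus idfun Y (line idfun (x ^+ p))).
  by have [] := ssum_satmod mult_one iY (line_submod idfun (x ^+ p)).
have [|zs szs zspan] := IHxs _ [seq x ^+ j * b | j <- iota 0 p, b <- bs] iYxp.
  move=> z; have := spans_power iA bspan z.
  by apply: adjs_mono => {}z /(spans_plus_line _ _ _ iY).
exists zs; first by rewrite szs size_allpairs size_iota expnSr mulnA.
move=> z; have := zspan z; apply: adjs_mono => {}z.
by move/(spans_plus_line _ _ _ iY).
Qed.

(** The combinations of [ys] over p-th powers of elements of [M]. *)
Fixpoint lincomb M ys : S -> Prop :=
  if ys is y :: ys' then
    fun z => exists a v, [/\ M a, lincomb M ys' v & z = Fr a * y + v]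
  else zeroset.

Lemma lincomb_submod M ys : ideal M -> submod Fr (lincomb M ys).
Proof.
case=> M0 MD MM; elim: ys => [|y ys [L0 LD LM]] /=; first exact: zeroset_submod.
split.
- by exists 0, 0; rewrite rmorph0 mul0r add0r.
- move=> _ _ [a [u [Ma Lu ->]]] [b [v [Mb Lv ->]]].
  exists (a + b), (u + v); split; [exact: MD | exact: LD |].
  by rewrite rmorphD; ring.
- move=> c _ [a [u [Ma Lu ->]]]; exists (c * a), (Fr c * u).
  by split; [exact: MM | exact: LM | rewrite rmorphM; ring].
Qed.

Lemma lincomb_mem M ys x y : ideal M -> M x -> y \in ys -> lincomb M ys (Fr x * y).
Proof.
move=> iM Mx; elim: ys => //= b ys IHys; rewrite inE => /orP[/eqP->|/IHys Ly].
  by exists x, 0; rewrite addr0; split=> //; case: (lincomb_submod ys iM).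
by exists 0, (Fr x * y); rewrite rmorph0 mul0r add0r; split=> //; case: iM.
Qed.

(** The equation for the first generator y has the form (1 - a) ^ p * y = n + v, with
    1 - a a unit, so y can be removed from the list of generators. *)
Lemma nakayama M N ys : ideal M -> (forall a, M a -> exists u, (1 - a) * u = 1) ->
    submod Fr N -> (forall z, plus Fr N (lincomb M ys) z) ->
  forall z, N z.
Proof.
move=> iM unitM [N0 ND NM]; elim: ys => [|y ys IHys] yspan z.
  have [w [n [_ [-> Nn -> e]]]] := yspan z.
  by move: e; rewrite rmorph1 mul1r addr0 => ->.
have [L0 LD LM] := lincomb_submod ys iM.
apply: IHys => {}z.
have [_ [n [_ [-> Nn [a [v [Ma Lv ->]]] ey]]]] := yspan y.
have [u ua] := unitM a Ma.
have y_eq : y = Fr u * (n + v).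
  have -> : n + v = Fr (1 - a) * y.
    by move: ey; rewrite !rmorph1 mul1r rmorphB rmorph1 mulrBl mul1r => {1}->; ring.
  by rewrite mulrA -rmorphM [u * _]mulrC ua rmorph1 mul1r.
have [_ [n1 [_ [-> Nn1 [b [v1 [Mb Lv1 ->]]] ez]]]] := yspan z.
exists 1, (n1 + Fr b * (Fr u * n)), (Fr b * (Fr u * v) + v1); split=> //.
- by apply: ND => //; do 2!apply: (NM).
- by apply: LD => //; do 2!apply: (LM).
- by rewrite ez [in LHS]y_eq; ring.
Qed.

(** When [ys] spans over p-th powers, its combinations with coefficients in [M] form an
    ideal, namely the one generated by the p-th powers of elements of [M]. *)
Lemma powers_lincomb M xs ys : ideal M -> (forall x, x \in xs -> M x) ->
    (forall z, spans Fr zeroset ys z) ->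
  sle (spans idfun zeroset [seq x ^+ p | x <- xs]) (lincomb M ys).
Proof.
move=> iM xsM yspan; have [L0 LD LM] := lincomb_submod ys iM.
suff: sle (spans idfun zeroset [seq x ^+ p | x <- xs])
          (fun z => forall s, lincomb M ys (s * z)).
  by move=> H z /H/(_ 1); rewrite mul1r.
apply: adjs_min.
- apply: submod_satmod; split.
  + by move=> s; rewrite mulr0.
  + by move=> x y Lx Ly s; rewrite mulrDr; apply: LD.
  + by move=> a x Lx s; rewrite mulrA.
- by move=> _ -> s; rewrite mulr0.
move=> _ /mapP[x x_xs ->] s; rewrite -(frobE charS) mulrC.
suff: sle (spans Fr zeroset ys) (fun s => lincomb M ys (Fr x * s)) by apply.
apply: adjs_min.
- apply: submod_satmod; split; first by rewrite mulr0.
    by move=> a b La Lb; rewrite mulrDr; apply: LD.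
  by move=> a b Lb; rewrite mulrCA; apply: LM.
- by move=> _ ->; rewrite mulr0.
- by move=> y; apply: lincomb_mem => //; apply: xsM.
Qed.
End Spans.
Arguments oneset {S}.
Arguments zeroset {S}.
Arguments mult_one {S}.

(** * Regular local rings are free over Frobenius *)

(** The second condition, that 1 has a unit coordinate, makes 1 part of a basis; it is
    what implies that [S] contains the p-th roots of its elements in its fraction
    field. *)
Definition frob_free (S : comNzRingType) (p : nat) (charS : p \in [pchar S]) :=
  exists (I : finType) (b : I -> S), basis_over (frob charS) b /\
    exists (u : I -> S) i v, 1 = \sum_j frob charS (u j) * b j /\ u i * v = 1.

Lemma F_finite_spanning (S : comNzRingType) p (charS : p \in [pchar S]) :
  F_finite p S -> exists n (g : 'I_n -> S), spanning (frob charS) g.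
Proof.
case=> charS' [n [g gP]]; exists n, g => x; have [c ->] := gP x.
exists c; apply: eq_bigr => i _; rewrite frobE.
by rewrite -[LHS]/(c i ^+ (p ^ 1) * g i) expn1.
Qed.

Lemma zeroset_prime (S : idomainType) : prime_set (@zeroset S).
Proof.
split; [exact: zeroset_submod | by move/eqP; rewrite oner_eq0 |].
by move=> x y /eqP; rewrite mulf_eq0 => /orP[]/eqP; [left | right].
Qed.

(** Kunz: some p ^ d * t elements span over the p-th powers, by Nakayama's lemma, and as
    many are independent, by the growth along a chain of primes of length d. *)
Lemma kunz_regular_local (S : idomainType) p (charS : p \in [pchar S]) :
  regular_local S -> F_finite p S -> frob_free charS.
Proof.
case=> nS [m [locS [d [[chain_d max_d] [x xP] _]]]] /(F_finite_spanning charS)[n [g gspan]].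
pose M : S -> Prop := fun z => z \in m.
have pM : prime_set M := local_prime nS locS; have mM := compl_mult pM.
have iM := local_ideal locS; have unitM : forall z, ~ M z -> exists y, z * y = 1 :=
  local_unit nS locS.
have p0 := zeroset_prime S.
pose ys := [seq g i | i <- enum 'I_n].
have [bs ibs bsP] := indep_extract charS ys pM.
have bspan z : adjs oneset (frob charS) M bs z.
  apply: (adjs_units mM (ideal_submod (frob charS) iM) unitM).
  suff: sle (adjs (compl M) (frob charS) M ys) (adjs (compl M) (frob charS) M bs).
    by apply; apply: spanning_spans => //; apply: ideal_submod.
  have sM : satmod (compl M) (frob charS) M by apply: prime_satmod_Fr.
  by apply: adjs_min => //; [exact: adjs_satmod | exact: sle_adjs].
have [cs scs ics] : exists2 cs, size cs = (p ^ d * size bs)%N &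
    indep charS zeroset cs.
  have [Y pY cY] := pchain_of_prime_chain chain_d.
  have nc0 : ~ pchain d.+1 (@zeroset S).
    by move=> c0; have := max_d _ (prime_chain_of_pchain (d := d.+1) p0 c0); rewrite ltnn.
  apply: (indep_primes (ys := ys) nS pM _ _ ibs p0) => //.
  - by move=> P; move=> pP; apply: (prime_le_maximal nS locS pP).
  - by move=> P Z z pP sZ; apply: spanning_spans => //; apply: compl_mult.
  suff <- : Y = zeroset by [].
  apply/funext => z; apply/propext; split; last by move->; case: pY => -[].
  move: z; apply: contrapT => nY0; apply: nc0; exists Y; split=> // z ->.
  by case: pY => -[].
pose xs := [seq x i | i <- enum 'I_d].
have xM i : M (x i).
  apply/xP; exists (fun j => (j == i)%:R).
  rewrite (bigD1 i) //= eqxx mul1r big1 ?addr0 // => j /negPf->.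
  by rewrite mul0r.
have i0 : submod (idfun : {rmorphism S -> S}) (@zeroset S) := zeroset_submod _.
have [|zs szs zspan] := spans_powers (charS := charS) (xs := xs) (bs := bs) i0.
  move=> z; apply: adjs_mono (bspan z) => {}z /xP[c ->].
  have [A0 AD AM] := adjs_submod mult_one xs i0.
  elim/big_ind: _ => // i _; apply: AM; apply: (adjs_mem mult_one i0).
  by apply: map_f; rewrite mem_enum.
have z0span : forall z, adjs oneset (frob charS) zeroset zs z.
  have sz : submod (frob charS) (adjs oneset (frob charS) zeroset zs).
    by apply: adjs_submod; [exact: mult_one | exact: zeroset_submod].
  have sL := lincomb_submod charS ys iM.
  apply: (nakayama (ys := ys) iM _ sz) => [a Ma|z].
    apply: unitM => M1a; case: pM => -[_ MD _] M1 _; apply: M1.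
    by rewrite -(subrK a 1); apply: MD.
  apply: (adjs_min _ _ _ (zspan z)).
  - by apply: ssum_satmod => //; apply: mult_one.
  - move=> w /(powers_lincomb (charS := charS) iM _ _) Lw.
    apply: sle_ssumr (submod0 sz) _ _; first exact: mult_one.
    apply: Lw; first by move=> _ /mapP[i _ ->]; exact: xM.
    by move=> y; apply: spanning_spans => //; [exact: mult_one | exact: zeroset_submod].
  - move=> c c_zs; apply: sle_ssuml (submod0 sL) _ _; first exact: mult_one.
    by apply: adjs_mem => //; [exact: mult_one | exact: zeroset_submod].
have zspanning := spans_spanning z0span.
have szcs : size cs = size zs by rewrite scs szs size_map size_enum_ord.
exists ('I_(size zs) : finType), (fun i : 'I_(size zs) => zs`_i); split.
  split=> //; apply: spanning_independent zspanning _.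
  by have := indep_independent p0 ics; rewrite szcs; apply.
have [u u1] := zspanning 1.
have [[i nMu]|allM] := pselect (exists i, ~ M (u i)).
  by have [v uv] := unitM _ nMu; exists u, i, v.
case: pM => _ nM1 _; case: nM1; rewrite [X in M X]u1.
have [M0 MD MM] := iM.
elim/big_ind: _ => // i _; rewrite frobE mulrC; apply: (MM).
rewrite -(prednK (prime_gt0 (pcharf_prime charS))) exprSr; apply: MM.
by apply: contrapT => nMu; apply: allM; exists i.
Qed.

(** * A criterion for finite F-representation type *)

Lemma basis_comp (A B C : comNzRingType) (f : {rmorphism A -> B})
    (g : {rmorphism B -> C}) (I J : finType) (b : I -> B) (c : J -> C) :
  basis_over f b -> basis_over g c ->
  basis_over (g \o f) (fun ij : I * J => g (b ij.1) * c ij.2).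
Proof.
have expand (t : I * J -> A) :
    \sum_ij (g \o f) (t ij) * (g (b ij.1) * c ij.2)
    = \sum_j g (\sum_i f (t (i, j)) * b i) * c j.
  transitivity (\sum_ij (g \o f) (t (ij.1, ij.2)) * (g (b ij.1) * c ij.2)).
    by apply: eq_bigr => -[i j] _.
  rewrite -(pair_bigA _ (fun i j => (g \o f) (t (i, j)) * (g (b i) * c j))) /=.
  rewrite exchange_big; apply: eq_bigr => j _.
  rewrite rmorph_sum mulr_suml; apply: eq_bigr => i _.
  by rewrite rmorphM mulrA.
case=> fspan find [gspan gind]; split=> [y|t].
  have [s ->] := gspan y; have [t tP] := choice (fun j => fspan (s j)).
  exists (fun ij => t ij.2 ij.1); rewrite expand; apply: eq_bigr => j _.
  by rewrite tP.
rewrite expand => /gind t0 [i j]; exact: (find (fun i => t (i, j)) (t0 j)).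
Qed.

Lemma basis_reindex (A B : comNzRingType) (f : {rmorphism A -> B}) (I J : finType)
    (h : J -> I) (b : I -> B) : bijective h -> basis_over f b ->
  basis_over f (b \o h).
Proof.
case=> h' hK h'K [fspan find]; split=> [y|t].
  have [t ->] := fspan y; exists (t \o h).
  by rewrite (reindex h) //; exists h' => i _.
rewrite (reindex h') /=; last by exists h => i _.
under eq_bigr => i _ do rewrite h'K.
by move=> /(find (t \o h')) t0 j; rewrite -(hK j); apply: t0.
Qed.

Lemma basis_ord (A B : comNzRingType) (f : {rmorphism A -> B}) (I : finType)
    (b : I -> B) : basis_over f b -> exists n (c : 'I_n -> B), basis_over f c.
Proof.
exists #|I|, (b \o enum_val); apply: basis_reindex => //.
exact: enum_val_bij.
Qed.

Fixpoint frobX (S : comNzRingType) p (charS : p \in [pchar S]) e : {rmorphism S -> S} :=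
  if e is e'.+1 then frob charS \o frobX charS e' else idfun.

Lemma frobXE (S : comNzRingType) p (charS : p \in [pchar S]) e x :
  frobX charS e x = x ^+ (p ^ e).
Proof.
elim: e x => [|e IHe] x //=.
by rewrite frobE IHe -exprM -expnSr.
Qed.

Lemma frob_free_basis (S : comNzRingType) p (charS : p \in [pchar S]) e :
  frob_free charS -> exists (I : finType) (b : I -> S), basis_over (frobX charS e) b.
Proof.
case=> I [b [fb _]]; elim: e => [|e [J [c fc]]].
  exists ('I_1 : finType), (fun=> 1); split=> [y|t].
    by exists (fun=> y); rewrite big_ord1 mulr1.
  by rewrite big_ord1 mulr1 => t0 i; rewrite ord1.
by exists (J * I)%type, (fun ij => frob charS (c ij.1) * b ij.2); apply: basis_comp.
Qed.

Section InverseLinear.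
Variables (R : nzRingType) (M N : lmodType R) (f : {linear M -> N}) (g : N -> M).
Hypotheses (fK : cancel f g) (gK : cancel g f).

Let g_linear : linear g.
Proof. by move=> a x y; apply: (can_inj fK); rewrite linearP !gK. Qed.

Lemma lmod_iso_inverse : lmod_iso N M.
Proof.
pose gL := GRing.isLinear.Build R N M *:%R g g_linear.
pose h : {linear N -> M} := HB.pack g gL.
by exists h; exists f.
Qed.
End InverseLinear.

Lemma lmod_iso_sym (R : nzRingType) (M N : lmodType R) : lmod_iso M N -> lmod_iso N M.
Proof. by case=> f [g fK gK]; apply: lmod_iso_inverse fK gK. Qed.

Lemma bijective_surj_inj (A B : Type) (f : A -> B) :
  injective f -> (forall y, exists x, f x = y) -> bijective f.
Proof.
move=> finj /choice[g gK]; exists g => // x; apply: finj; exact: gK.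
Qed.

Section SingleSummand.
Variables (R : nzRingType) (s : nat) (M : 'I_s -> lmodType R) (n : 'I_s -> nat).
Variables (X : lmodType R) (i0 : 'I_s) (f : {linear {ffun 'I_(n i0) -> M i0} -> X}).
Hypotheses (n0 : forall i, i != i0 -> n i = 0%N) (f_bij : bijective f).

Let T := dirsum (fun i : 'I_s => {ffun 'I_(n i) -> M i}).
Let proj (u : T) : X := f (u i0).

Let proj_linear : linear proj.
Proof. by move=> a u v; rewrite /proj !ffunE linearP. Qed.

(** When [n] vanishes off [i0], the direct sum is its [i0]-th summand. *)
Lemma single_summand : lmod_iso X T.
Proof.
apply: lmod_iso_sym.
pose gL := GRing.isLinear.Build R T X *:%R proj proj_linear.
pose h : {linear T -> X} := HB.pack proj gL.
exists h; apply: bijective_surj_inj => [u v /(bij_inj f_bij) uv0|x].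
  apply/ffunP => i; have [->//|/n0 ni0] := eqVneq i i0.
  by apply/ffunP => -[k lt_k]; exfalso; rewrite ni0 in lt_k.
have [f' _ f'K] := f_bij.
exists (finfun (dfwith (fun i => 0 : {ffun 'I_(n i) -> M i}) (f' x))).
by rewrite /= /proj ffunE dfwith_in f'K.
Qed.
End SingleSummand.

Lemma lmod_iso_dirsum (R : nzRingType) (s : nat) (M : 'I_s -> lmodType R)
    (X Y : lmodType R) (i0 : 'I_s) (N : nat) (f : {linear {ffun 'I_N -> Y} -> X}) :
    M i0 = Y -> bijective f ->
  exists n : 'I_s -> nat, lmod_iso X (dirsum (fun i : 'I_s => {ffun 'I_(n i) -> M i})).
Proof.
move=> eY; case: _ / eY f => f f_bij.
pose n i := if i == i0 then N else 0%N.
have n_i0 : n i0 = N by rewrite /n eqxx.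
have n0 i : i != i0 -> n i = 0%N by rewrite /n => /negPf->.
exists n; move: n n_i0 n0 => n n_i0; case: _ / n_i0 f f_bij => f f_bij n0.
exact: single_summand n0 f_bij.
Qed.

Section FinfunOne.
Variables (R : nzRingType) (X : lmodType R).

Let eval (u : {ffun 'I_1 -> X}) : X := u ord0.

Let eval_linear : linear eval.
Proof. by move=> a u v; rewrite /eval !ffunE. Qed.

Lemma finfun_one : exists f : {linear {ffun 'I_1 -> X} -> X}, bijective f.
Proof.
pose gL := GRing.isLinear.Build R {ffun 'I_1 -> X} X *:%R eval eval_linear.
pose h : {linear {ffun 'I_1 -> X} -> X} := HB.pack eval gL.
exists h, (fun x => [ffun=> x]) => [u|x]; last by rewrite /= /eval ffunE.
by apply/ffunP => i; rewrite ffunE ord1.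
Qed.
End FinfunOne.

(** Restriction of scalars of [S] along [phi]. *)
Definition pullback (R S : comNzRingType) (phi : {rmorphism R -> S}) : Type := S.

Section Pullback.
Variables (R S : comNzRingType) (phi : {rmorphism R -> S}).
Local Notation T := (pullback phi).

HB.instance Definition _ := GRing.Zmodule.copy T S.

Definition pullback_scale (r : R) (x : T) : T := (phi r * (x : S) : S).

Fact pullback_scaleA a b (x : T) :
  pullback_scale a (pullback_scale b x) = pullback_scale (a * b) x.
Proof. by rewrite /pullback_scale rmorphM mulrA. Qed.
Fact pullback_scale1 : left_id 1 pullback_scale.
Proof. by move=> x; rewrite /pullback_scale rmorph1 mul1r. Qed.
Fact pullback_scaleDr : right_distributive pullback_scale +%R.
Proof. by move=> a x y; apply: mulrDr. Qed.
Fact pullback_scaleDl (x : T) : {morph pullback_scale^~ x : a b / a + b}.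
Proof. by move=> a b; rewrite /pullback_scale rmorphD; apply: mulrDl. Qed.

HB.instance Definition _ := GRing.Zmodule_isLmodule.Build R T
  pullback_scaleA pullback_scale1 pullback_scaleDr pullback_scaleDl.
End Pullback.

Section PowersInSubring.
Variables (S R : comNzRingType) (p : nat).
Variables (charS : p \in [pchar S]) (charR : p \in [pchar R]).
Variables (j : {rmorphism S -> R}) (e : nat) (phi : {rmorphism R -> S}).
Hypotheses (j_inj : injective j) (phiE : forall r, j (phi r) = r ^+ (p ^ e)).

Lemma phi_j s : phi (j s) = frobX charS e s.
Proof. by apply: j_inj; rewrite phiE frobXE rmorphXn. Qed.

Section Coordinates.
Variables (c N : nat) (b : 'I_N -> R).
Hypothesis b_basis : basis_over (j \o frobX charS c) b.

Let X : lmodType R := frob_push charR (e + c) R^o.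
Let coords : lmodType R := {ffun 'I_N -> pullback phi}.
Let g (t : coords) : X := (\sum_i (j \o frobX charS c) (t i) * b i : R).

Let g_linear : linear g.
Proof.
move=> a t u.
suff : \sum_i (j \o frobX charS c) ((a *: t + u) i) * b i =
    a ^+ (p ^ (e + c)) * (\sum_i (j \o frobX charS c) (t i) * b i)
    + \sum_i (j \o frobX charS c) (u i) * b i by [].
rewrite mulr_sumr -big_split; apply: eq_bigr => i _ /=.
rewrite !ffunE -[(a *: t i)]/(phi a * t i).
by rewrite 2!rmorphD 2!rmorphM frobXE !rmorphXn /= phiE -exprM -expnD; ring.
Qed.

(** In the coordinates of the basis [b] over p ^ c-th powers of [S], an element r acts
    on ^(e+c) R as multiplication by phi(r), because
    r ^ (p ^ (e+c)) is the p ^ c-th power of phi(r). *)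
Lemma frob_push_coords : exists f : {linear coords -> X}, bijective f.
Proof.
pose gL := GRing.isLinear.Build R coords X *:%R g g_linear.
pose h : {linear coords -> X} := HB.pack g gL.
case: b_basis => bspan bind.
exists h; apply: bijective_surj_inj => [t u /= tu|y].
  apply/eqP; rewrite -subr_eq0; apply/eqP/ffunP => i; rewrite !ffunE.
  apply: (bind (fun i => (t i : S) - u i)).
  have gB : \sum_i (j \o frobX charS c) ((t i : S) - u i) * b i = (g t : R) - (g u : R).
    by rewrite -sumrB; apply: eq_bigr => k _; rewrite rmorphB mulrBl.
  by rewrite gB [g t]tu subrr.
have [t ->] := bspan y; exists [ffun i => t i].
by rewrite /= /g; apply: eq_bigr => i _; rewrite ffunE.
Qed.
End Coordinates.

Lemma fg_frob_push c N (b : 'I_N -> R) : spanning (j \o frobX charS c) b ->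
  fg_module (frob_push charR c R^o).
Proof.
move=> bspan; exists N, b => x; have [t ->] := bspan x.
exists (j \o t); apply: eq_bigr => i _.
by rewrite -[RHS]/(j (t i) ^+ (p ^ c) * b i) /= frobXE rmorphXn.
Qed.

Lemma fg_pullback N (b : 'I_N -> S) : spanning (frobX charS e) b ->
  fg_module (pullback phi).
Proof.
move=> bspan; exists N, b => x; have [t ->] := bspan x.
exists (j \o t); apply: eq_bigr => i _.
by rewrite -[RHS]/(phi (j (t i)) * b i) phi_j.
Qed.

(** The modules ^0 R, ..., ^(e-1) R and [pullback phi] suffice. *)
Lemma FFRT_of_powers (I : finType) (b : I -> R) :
  frob_free charS -> basis_over j b -> FFRT p R.
Proof.
move=> freeS b_basis.
have basisS k : exists N (c : 'I_N -> S), basis_over (frobX charS k) c.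
  by have [J [c /basis_ord]] := frob_free_basis k freeS.
have basisR k : exists N (c : 'I_N -> R), basis_over (j \o frobX charS k) c.
  by have [N [c cb]] := basisS k; apply: basis_ord (basis_comp cb b_basis).
pose M k : lmodType R := 
    if (k < e)%N then frob_push charR k R^o : lmodType R else pullback phi : lmodType R.
exists charR, e.+1, (fun i : 'I_e.+1 => M i); split=> [i|k].
  rewrite /M; case: ifP => _.
    by have [N [c [cspan _]]] := basisR i; apply: fg_frob_push cspan.
  by have [N [c [cspan _]]] := basisS e; apply: fg_pullback cspan.
have [lt_ke|le_ek] := ltnP k e.
  have eM : M (Ordinal (leqW lt_ke)) = frob_push charR k R^o by rewrite /M lt_ke.
  by have [f f_bij] := finfun_one (frob_push charR k R^o); apply: lmod_iso_dirsum eM f_bij.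
have eM : M (@ord_max e) = pullback phi by rewrite /M ltnn.
have [N [c cb]] := basisR (k - e)%N.
have [f f_bij] := frob_push_coords cb.
rewrite subnKC // in f f_bij.
exact: lmod_iso_dirsum eM f_bij.
Qed.
End PowersInSubring.

(** * Adjoining a root *)

Section Criterion.
Variables (S R : comNzRingType) (p : nat).
Variables (charS : p \in [pchar S]) (charR : p \in [pchar R]).
Variables (j : {rmorphism S -> R}) (e : nat).
Hypotheses (j_inj : injective j) (powj : forall r : R, exists s, j s = r ^+ (p ^ e)).

Let phi (r : R) : S := sval (cid (powj r)).

Let phiE r : j (phi r) = r ^+ (p ^ e).
Proof. by rewrite /phi; case: cid. Qed.

Let phi_zmod : zmod_morphism phi.
Proof.
by move=> x y; apply: j_inj; rewrite rmorphB !phiE -!(frobXE charR) rmorphB.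
Qed.

Let phi_monoid : monoid_morphism phi.
Proof.
split=> [|x y]; apply: j_inj; first by rewrite phiE expr1n rmorph1.
by rewrite rmorphM !phiE exprMn.
Qed.

(** The map that sends r to the preimage of r ^ (p ^ e) is a ring morphism, because
    [j] is injective. *)
Theorem FFRT_criterion (I : finType) (b : I -> R) :
  frob_free charS -> basis_over j b -> FFRT p R.
Proof.
pose phi_add := GRing.isZmodMorphism.Build R S phi phi_zmod.
pose phi_mul := GRing.isMonoidMorphism.Build R S phi phi_monoid.
pose h : {rmorphism R -> S} := HB.pack phi phi_add phi_mul.
exact: (FFRT_of_powers charR (phi := h) j_inj phiE).
Qed.
End Criterion.

(** For k = 1, compare in a ^ p * 1 = b ^ p * f the coordinate at which 1 has a
    unit. *)
Lemma frob_free_root (S : idomainType) p (charS : p \in [pchar S]) k (a b f : S) :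
  frob_free charS -> a ^+ (p ^ k) = b ^+ (p ^ k) * f -> exists c, a = b * c.
Proof.
case=> I [z [[zspan zind] [u [i [v [u1 uv]]]]]].
elim: k a b f => [|k IHk] a b f; first by rewrite !expr1 => ->; exists f.
rewrite expnSr !exprM => ab; have [t ft] := zspan f.
have /zind/(_ i)/eqP : \sum_l frob charS (a ^+ (p ^ k) * u l - b ^+ (p ^ k) * t l) * z l = 0.
  under eq_bigr => l _ do rewrite rmorphB !rmorphM mulrBl -!mulrA !frobE.
  by rewrite sumrB -!mulr_sumr -u1 -ft mulr1 ab subrr.
rewrite subr_eq0 => /eqP au; apply: (IHk _ _ (t i * v)).
by rewrite mulrA -au -mulrA uv mulr1.
Qed.

(** (X - g) ^ (n * p ^ a) is (Y - g ^ (p ^ a)) ^ n at Y = X ^ (p ^ a), and this is the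
    second coefficient of the latter. *)
Lemma coef_XsubC_exp_pchar (L : comNzRingType) p (charL : p \in [pchar L]) (g : L) a n :
  (0 < n)%N ->
  (('X - g%:P) ^+ (n * p ^ a))`_(n.-1 * p ^ a) = - (g ^+ (p ^ a) *+ n).
Proof.
move=> n_gt0; have p_gt0 := prime_gt0 (pcharf_prime charL).
have charLX : p \in [pchar {poly L}] by rewrite pchar_poly.
rewrite mulnC exprM -(frobXE charLX) rmorphB !frobXE -polyC_exp.
have -> : ('X^(p ^ a) - (g ^+ (p ^ a))%:P) ^+ n =
    (('X - (g ^+ (p ^ a))%:P) ^+ n) \Po 'X^(p ^ a).
  by rewrite (rmorphXn (comp_poly 'X^(p ^ a))) /= comp_polyB comp_polyX comp_polyC.
rewrite coef_comp_poly_Xn ?expn_gt0 ?p_gt0 // dvdn_mull // mulnK ?expn_gt0 ?p_gt0 //.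
have := @coefPn_prod_XsubC L (nseq n (g ^+ (p ^ a))).
rewrite size_nseq !big_nseq iter_mulr_1 iter_addr_0; apply.
by rewrite -lt0n.
Qed.

(** Pseudo-division of X ^ n - h = (X - g) ^ n by a relation P of least degree leaves
    the remainder 0, so over [L] the polynomial P divides (X - g) ^ n. *)
Lemma minimal_relation (S : idomainType) (L : fieldType) (j : {rmorphism S -> L})
    (g : L) (h : S) n (P0 : {poly S}) :
    injective j -> (0 < n)%N -> g ^+ n = j h ->
    forall charL : [pchar L].-nat n,
    P0 != 0 -> (size P0 <= n)%N -> (map_poly j P0).[g] = 0 ->
  exists (P : {poly S}) (l : S) m,
    [/\ l != 0, (0 < m < n)%N & map_poly j P = j l *: ('X - g%:P) ^+ m].
Proof.
move=> j_inj n_gt0 gn charL P0_neq0 szP0 P0g.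
pose rel k := `[< exists P : {poly S}, [/\ P != 0, size P = k & (map_poly j P).[g] = 0] >].
have exrel : exists k, rel k by exists (size P0); apply/asboolP; exists P0.
case: (ex_minnP exrel) => k /asboolP[P [P_neq0 szP Pg]] kmin.
have le_kn : (k <= n)%N by apply: leq_trans (kmin _ _) szP0; apply/asboolP; exists P0.
have [d dE] : exists d : {poly S}, map_poly j d = ('X - g%:P) ^+ n.
  exists ('X^n - h%:P).
  rewrite rmorphB /= map_polyXn map_polyC /= -gn polyC_exp.
  by rewrite exprDn_pchar // ?exprNn_pchar // (eq_pnat _ (pchar_poly L)).
have jl_neq0 : j (lead_coef P) != 0.
  by rewrite -(rmorph0 j) (inj_eq j_inj) lead_coef_eq0.
have dvd_d : map_poly j P %| ('X - g%:P) ^+ n.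
  have modd : d %% P = 0.
    apply/eqP; apply: contraT => mod_neq0.
    have : (size (d %% P)%R < size P)%N by rewrite ltn_modp.
    rewrite szP ltnNge => /negP[]; apply: kmin; apply/asboolP; exists (d %% P).
    split=> //; have e := congr1 (map_poly j) (Pdiv.Idomain.divp_eq d P).
    have := congr1 (fun Q => Q.[g]) e.
    rewrite map_polyZ rmorphD /= rmorphM /= dE hornerZ hornerD hornerM Pg mulr0 add0r => <-.
    by rewrite horner_exp !hornerE subrr expr0n -[n]prednK // mulr0.
  have := congr1 (map_poly j) (Pdiv.Idomain.divp_eq d P).
  rewrite modd addr0 map_polyZ rmorphM /= dE rmorphXn /= => e.
  rewrite -(@dvdpZr _ (j (lead_coef P) ^+ scalp d P)) ?expf_neq0 // e.
  exact: dvdp_mulIr.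
have /dvdp_exp_XsubCP[m le_mn /eqpfP] := dvd_d.
rewrite (monicP (monic_exp m (monicXsubC g))) divr1 lead_coef_map_inj ?rmorph0 // => Pm.
exists P, (lead_coef P), m; split=> //; first by rewrite lead_coef_eq0.
have := congr1 (fun Q : {poly L} => size Q) Pm.
rewrite size_scale // size_exp_XsubC size_map_inj_poly ?rmorph0 // szP => km.
rewrite -[(m < n)%N]/(m.+1 <= n)%N -km le_kn andbT.
rewrite lt0n; apply/eqP => m0; move: jl_neq0; have := Pg.
by rewrite Pm m0 expr0 hornerZ hornerC mulr1 => ->; rewrite eqxx.
Qed.

(** Division with remainder by the monic polynomial [D]. *)
Lemma monic_spanning (S R : comNzRingType) (j : {rmorphism S -> R}) (x : R)
    (D : {poly S}) n : D \is monic -> size D = n.+1 -> (map_poly j D).[x] = 0 ->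
  forall P : {poly S}, exists t : 'I_n -> S,
    (map_poly j P).[x] = \sum_i j (t i) * x ^+ i.
Proof.
move=> monD szD Dx P; pose Q := Pdiv.CommonRing.rmodp P D.
have szQ : (size Q <= n)%N.
  by rewrite -ltnS -szD Pdiv.CommonRing.ltn_rmodpN0 // monic_neq0.
exists (fun i : 'I_n => Q`_i).
rewrite [in LHS](Pdiv.RingMonic.rdivp_eq monD P) rmorphD rmorphM /= hornerD.
rewrite hornerM_comm; last by rewrite /comm_poly mulrC.
rewrite Dx mulr0 add0r (horner_coef_wide (n := n)).
  by apply: eq_bigr => i _; rewrite coef_map.
exact: leq_trans (size_poly _ _) szQ.
Qed.

Section Adjoin.
Variables (S : idomainType) (L : fieldType) (j : {rmorphism S -> L}) (g : L).
Variables (p e : nat) (charS : p \in [pchar S]) (f : S).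
Hypotheses (j_inj : injective j) (freeS : frob_free charS).
Hypothesis (ge : g ^+ (p ^ e) = j f).

Let p_gt0 : (0 < p)%N. Proof. exact: prime_gt0 (pcharf_prime charS). Qed.
Let charL : p \in [pchar L]. Proof. exact: rmorph_pchar j _ charS. Qed.

(** Let n = p ^ k be the least power of p with g ^ n in [S]. A relation of degree less
    than n would give l * (X - g) ^ m with coefficients in [S] and 0 < m < n. Write
    m = n' * p ^ a with n' prime to p: the coefficient - l * n' * g ^ (p ^ a)
    makes g ^ (p ^ a) a fraction over [S], hence an element of [S], although a < k. *)
Lemma powers_basis : exists n, (0 < n)%N /\ exists h, g ^+ n = j h /\
  forall t : 'I_n -> S, \sum_i j (t i) * g ^+ i = 0 -> forall i, t i = 0.
Proof.
pose inS k := `[< exists h, g ^+ (p ^ k) = j h >].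
have exk : exists k, inS k by exists e; apply/asboolP; exists f.
case: (ex_minnP exk) => k /asboolP[h gh] kmin.
have pk_gt0 : (0 < p ^ k)%N by rewrite expn_gt0 p_gt0.
exists (p ^ k)%N; split=> //; exists h; split=> // t tg.
pose P0 := \poly_(i < p ^ k) (if insub i is Some i' then t i' else 0).
have P0E (i : 'I_(p ^ k)) : P0`_i = t i by rewrite coef_poly ltn_ord valK.
suff P0_0 : P0 = 0 by move=> i; rewrite -P0E P0_0 coef0.
apply/eqP; apply: contraT => P0_neq0.
have charLk : [pchar L].-nat (p ^ k)%N.
  by rewrite (eq_pnat _ (pcharf_eq charL)) pnatX pnat_id ?(pcharf_prime charL).
have szP0 : (size P0 <= p ^ k)%N by apply: size_poly.
have P0g : (map_poly j P0).[g] = 0.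
  rewrite (horner_coef_wide (n := p ^ k)); last by rewrite size_map_inj_poly ?rmorph0.
  by rewrite -[RHS]tg; apply: eq_bigr => i _; rewrite coef_map P0E.
have [P [l [m [l_neq0 /andP[m_gt0 lt_m] PE]]]] :=
  minimal_relation j_inj pk_gt0 gh charLk P0_neq0 szP0 P0g.
have [n p_n mE] := pfactor_coprime (pcharf_prime charS) m_gt0.
set a := logn p m in mE.
have n_gt0 : (0 < n)%N by case: n mE p_n {PE} => // mE; rewrite mE in m_gt0.
have lt_ak : (a < k)%N.
  rewrite -(ltn_exp2l _ _ (prime_gt1 (pcharf_prime charS))); apply: leq_ltn_trans lt_m.
  by rewrite mE leq_pmull.
have := congr1 (fun Q : {poly L} => Q`_(n.-1 * p ^ a)) PE.
rewrite coef_map coefZ mE (coef_XsubC_exp_pchar charL) // => eP.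
pose l' := l *+ n; pose u := - P`_(n.-1 * p ^ a).
have lu : j l' * g ^+ (p ^ a) = j u.
  by rewrite /u rmorphN eP mulrN opprK rmorphMn /= mulrnAl mulrnAr.
have l'_neq0 : l' != 0.
  rewrite /l' -mulr_natr mulf_neq0 // -(dvdn_pcharf charS).
  by rewrite -prime_coprime // (pcharf_prime charS).
have [|c uc] := frob_free_root (k := (k - a)%N) (a := u) (b := l') (f := h) freeS.
  apply: j_inj; rewrite rmorphM !rmorphXn /= -lu exprMn -exprM -expnD subnKC ?(ltnW lt_ak) //.
  by rewrite gh.
have : (k <= a)%N.
  apply: kmin; apply/asboolP; exists c.
  have jl'_neq0 : j l' != 0 by rewrite -(rmorph0 j) (inj_eq j_inj).
  by apply: (mulfI jl'_neq0); rewrite lu uc rmorphM.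
by rewrite leqNgt lt_ak.
Qed.

Lemma FFRT_adjoin : FFRT p (adjoin j g).
Proof.
pose R : comNzRingType := adjoin j g.
have inR (P : {poly S}) : (map_poly j P).[g] \in adjoin_pred j g.
  by apply/asboolP; exists P.
pose mk P : R := Adjoin (inR P).
have mk_val P : val (mk P) = (map_poly j P).[g] by [].
pose jR0 s := mk s%:P.
have jR0_val s : val (jR0 s) = j s by rewrite mk_val map_polyC hornerC.
have jR_zmod : zmod_morphism jR0.
  by move=> x y; apply: val_inj; rewrite [RHS]rmorphB jR0_val rmorphB -!jR0_val.
have jR_monoid : monoid_morphism jR0.
  split=> [|x y]; apply: val_inj; first by rewrite jR0_val !rmorph1.
  by rewrite [RHS]rmorphM jR0_val rmorphM -!jR0_val.
pose jR_add := GRing.isZmodMorphism.Build S R jR0 jR_zmod.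
pose jR_mul := GRing.isMonoidMorphism.Build S R jR0 jR_monoid.
pose jR : {rmorphism S -> R} := HB.pack jR0 jR_add jR_mul.
have jR_val s : val (jR s) = j s by apply: jR0_val.
have jR_inj : injective jR.
  by move=> x y /(congr1 val); rewrite !jR_val => /j_inj.
have charR : p \in [pchar R] by apply: rmorph_pchar jR _ charS.
have powR (r : R) : exists s, jR s = r ^+ (p ^ e).
  case: r => x xP; have [P xE] := asboolP _ xP.
  exists (map_poly (frobX charS e) P).[f]; apply: val_inj.
  rewrite jR_val rmorphXn /= xE -(frobXE charL) -[RHS]horner_map frobXE ge.
  rewrite -horner_map -!map_poly_comp; congr (_.[_]); apply: eq_map_poly => s /=.
  by rewrite !frobXE rmorphXn.
have [n [n_gt0 [h [gh tind]]]] := powers_basis.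
apply: (FFRT_criterion charR jR_inj powR (b := fun i : 'I_n => mk 'X^i)) freeS _.
have sumE (t : 'I_n -> S) : val (\sum_i jR (t i) * mk 'X^i) = \sum_i j (t i) * g ^+ i.
  rewrite rmorph_sum; apply: eq_bigr => i _.
  have valM (x y : R) : val (x * y) = val x * val y by [].
  by rewrite -[LHS]/(val (jR (t i) * mk 'X^i)) valM jR_val mk_val map_polyXn hornerXn.
split=> [r|t t0].
  case: r => x xP; have [P xE] := asboolP _ xP.
  have [D [monD szD Dg]] : exists D : {poly S},
      [/\ D \is monic, size D = n.+1 & (map_poly j D).[g] = 0].
    exists ('X^n - h%:P); split; [exact: monicXnsubC | exact: size_XnsubC |].
    by rewrite rmorphB /= map_polyXn map_polyC !hornerE /= gh subrr.
  have [t tP] := monic_spanning monD szD Dg P.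
  by exists t; apply: val_inj; rewrite sumE /= xE tP.
by apply: tind; rewrite -sumE t0.
Qed.
End Adjoin.

(** * Polynomial rings *)

Lemma field_frob_free (k : fieldType) p (chark : p \in [pchar k]) :
  finite_degree (@pth_power p k) -> frob_free chark.
Proof.
case=> n [g gP].
have gspan : spanning (frob chark) g.
  move=> x; have [c [/choice[t tc] ->]] := gP x; exists t.
  by apply: eq_bigr => i _; rewrite frobE tc.
have p0 := zeroset_prime k; have m0 := compl_mult p0.
have s0 : submod (frob chark) (@zeroset k) by apply: zeroset_submod.
pose ys := [seq g i | i <- enum 'I_n].
have [bs ibs bsP] := indep_extract chark ys p0.
have sA : satmod (compl zeroset) (frob chark) (adjs (compl zeroset) (frob chark) zeroset bs).
  by apply: adjs_satmod => //; apply: prime_satmod_Fr.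
have unitk (x : k) : ~ zeroset x -> exists y, x * y = 1.
  by move=> /eqP x0; exists x^-1; rewrite mulfV.
have bspanning : spanning (frob chark) (fun i : 'I_(size bs) => bs`_i).
  apply: spans_spanning => z; apply: (adjs_units m0 s0 unitk).
  suff: sle (adjs (compl zeroset) (frob chark) zeroset ys)
            (adjs (compl zeroset) (frob chark) zeroset bs).
    by apply; apply: spanning_spans.
  by apply: adjs_min => //; apply: sle_adjs.
exists ('I_(size bs) : finType), (fun i : 'I_(size bs) => bs`_i); split.
  by split=> //; apply: indep_independent.
have [u u1] := bspanning 1.
have [[i ui]|u0] := pselect (exists i, u i != 0).
  by exists u, i, (u i)^-1; split=> //; rewrite mulfV.
have /eqP := u1; rewrite big1 ?oner_eq0 // => i _.
have -> : u i = 0 by apply/eqP; apply: contrapT => /negP ui; apply: u0; exists i.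
by rewrite rmorph0 mul0r.
Qed.

Section PolynomialRing.
Variables (k : fieldType) (n p : nat) (chark : p \in [pchar k]).
Variable (charM : p \in [pchar {mpoly k[n]}]).

Let p_gt0 : (0 < p)%N. Proof. exact: prime_gt0 (pcharf_prime chark). Qed.

Let expr0p (R : comNzRingType) : (0 : R) ^+ p = 0.
Proof. by rewrite expr0n gtn_eqF. Qed.

Let pnatk : [pchar k].-nat p.
Proof. by rewrite (eq_pnat _ (pcharf_eq chark)) pnat_id ?(pcharf_prime chark). Qed.
Let pnatM : [pchar {mpoly k[n]}].-nat p.
Proof. by rewrite (eq_pnat _ (pcharf_eq charM)) pnat_id ?(pcharf_prime chark). Qed.

Definition residue (a : {ffun 'I_n -> 'I_p}) : 'X_{1..n} := [multinom (a i : nat) | i < n].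

Lemma residue_eq (m m' : 'X_{1..n}) (a a' : {ffun 'I_n -> 'I_p}) :
  ((m *+ p + residue a)%MM == (m' *+ p + residue a')%MM) = (m == m') && (a == a').
Proof.
apply/eqP/andP => [e|[/eqP-> /eqP->]//].
have e_i i : (m i * p + a i = m' i * p + a' i)%N.
  by have := congr1 (fun m : 'X_{1..n} => m i) e; rewrite !mnmDE !mulmnE !mnmE.
split; apply/eqP.
  apply/mnmP => i; have := congr1 (divn^~ p) (e_i i).
  by rewrite !divnMDl // !divn_small // !addn0.
apply/ffunP => i; apply: val_inj; have := congr1 (modn^~ p) (e_i i).
by rewrite !modnMDl !modn_small.
Qed.

(** Division with remainder by p in every exponent. *)
Lemma residue_exists (m : 'X_{1..n}) :
  exists (m' : 'X_{1..n}) a, m = (m' *+ p + residue a)%MM.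
Proof.
exists [multinom (m i %/ p)%N | i < n], [ffun i => Ordinal (ltn_pmod (m i) p_gt0)].
by apply/mnmP => i; rewrite mnmDE mulmnE !mnmE ffunE -divn_eq.
Qed.

Lemma mcoeff_frob_residue (s : {mpoly k[n]}) m a a' :
  (s ^+ p * 'X_[residue a])@_(m *+ p + residue a') = (s@_m) ^+ p *+ (a == a').
Proof.
elim/mpolyind: s => [|c m' q _ _ IHq].
  by rewrite mcoeff0 !expr0p mul0r mcoeff0 mul0rn.
rewrite exprDn_pchar // mulrDl mcoeffD IHq mcoeffD mcoeffZ mcoeffX exprDn_pchar //.
rewrite mulrnDl; congr (_ + _).
rewrite exprZn -scalerAl mpolyXn -mpolyXD mcoeffZ mcoeffX residue_eq exprMn.
by case: (m' == m); case: (a == a'); rewrite ?expr1n ?expr0p ?mulr0 ?mulr1.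
Qed.

(** The basis consists of the products of a basis of [k] over [k ^ p] with the monomials
    whose exponents are all less than p. *)
Lemma polynomial_frob_free : finite_degree (@pth_power p k) -> frob_free charM.
Proof.
move=> /(field_frob_free chark)[I [b [[bspan bind] [u [i0 [v [u1 uv]]]]]]].
pose c (ia : I * {ffun 'I_n -> 'I_p}) := (b ia.1)%:MP * 'X_[residue ia.2] : {mpoly k[n]}.
have sum_residue (t : I -> {mpoly k[n]}) a :
    \sum_ia frob charM (t ia.1 *+ (ia.2 == a)) * c ia
    = \sum_i frob charM (t i) * (b i)%:MP * 'X_[residue a].
  transitivity (\sum_i \sum_a' frob charM (t i *+ (a' == a)) * c (i, a')).
    by rewrite pair_bigA; apply: eq_bigr => -[].
  apply: eq_bigr => i _; rewrite (bigD1 a) //= eqxx mulr1n mulrA big1 ?addr0 // => a'.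
  by move/negPf->; rewrite mulr0n rmorph0 mul0r.
exists (I * {ffun 'I_n -> 'I_p})%type, c; split; first split.
- move=> y; elim/mpolyind: y => [|d m q _ _ [t ->]].
    by exists (fun=> 0); rewrite big1 // => ia _; rewrite rmorph0 mul0r.
  have [s ds] := bspan d; have [m' [a ->]] := residue_exists m.
  exists (fun ia => (s ia.1 *: 'X_[m']) *+ (ia.2 == a) + t ia).
  under [RHS]eq_bigr => ia _ do rewrite rmorphD mulrDl.
  rewrite big_split /= (sum_residue (fun i => s i *: 'X_[m'])); congr (_ + _).
  rewrite ds scaler_suml; apply: eq_bigr => i _.
  by rewrite !frobE exprZn mpolyXn mpolyXD -!mul_mpolyC mpolyCM; ring.
- move=> t t0 [i a]; apply/mpolyP => m; rewrite mcoeff0.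
  apply: (bind (fun i => (t (i, a))@_m)).
  have := congr1 (fun q : {mpoly k[n]} => q@_(m *+ p + residue a)) t0.
  rewrite mcoeff0 => tm0; rewrite -[RHS]tm0 (raddf_sum (mcoeff _)).
  transitivity (\sum_i \sum_a' (frob charM (t (i, a')) * c (i, a'))@_(m *+ p + residue a)).
    apply: eq_bigr => l _; rewrite (bigD1 a) //= big1 ?addr0 => [|a' /negPf a'a].
      by rewrite frobE mulrCA mul_mpolyC mcoeffZ mcoeff_frob_residue eqxx mulrC.
    by rewrite frobE mulrCA mul_mpolyC mcoeffZ mcoeff_frob_residue a'a mulr0.
  by rewrite pair_bigA; apply: eq_bigr => -[].
pose a0 : {ffun 'I_n -> 'I_p} := [ffun=> Ordinal p_gt0].
exists (fun ia => (u ia.1)%:MP *+ (ia.2 == a0)), (i0, a0), v%:MP; split.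
  rewrite (sum_residue (fun i => (u i)%:MP)).
  have -> : residue a0 = 0%MM by apply/mnmP => i; rewrite !mnmE ffunE.
  rewrite mpolyX0; under [RHS]eq_bigr => i _ do rewrite mulr1.
  rewrite -[LHS]mpolyC1 u1 rmorph_sum; apply: eq_bigr => i _.
  by rewrite rmorphM !frobE rmorphXn.
by rewrite eqxx mulr1n -mpolyCM uv.
Qed.
End PolynomialRing.

(** * Hypersurfaces *)

Lemma mpoly_rmorph_ext (k B : comNzRingType) n (f g : {rmorphism {mpoly k[n]} -> B}) :
  (forall c, f c%:MP = g c%:MP) -> (forall i, f 'X_i = g 'X_i) -> f =1 g.
Proof.
move=> fgC fgX q; rewrite (mpolyE q) !rmorph_sum; apply: eq_bigr => m _.
rewrite -mul_mpolyC !rmorphM fgC; congr (_ * _).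
rewrite mpolyXE_id !rmorph_prod; apply: eq_bigr => i _.
by rewrite !rmorphXn fgX.
Qed.

Section OneVariable.
Variables (k : fieldType) (n : nat) (i : 'I_n.+1).

(** The embedding onto the polynomials that do not involve the [i]-th variable. *)
Definition widen_mpoly : {rmorphism {mpoly k[n]} -> {mpoly k[n.+1]}} :=
  mmap (@mpolyC n.+1 k) (fun l => 'X_(lift i l)).

(** A polynomial in all the variables, regarded as a polynomial in the [i]-th one. *)
Definition poly_of_mpoly : {rmorphism {mpoly k[n.+1]} -> {poly {mpoly k[n]}}} :=
  mmap (polyC \o @mpolyC n k) (fun l => if unlift i l is Some l' then ('X_l')%:P else 'X).

Lemma widen_mpolyC c : widen_mpoly c%:MP = c%:MP.
Proof. exact: mmapC. Qed.

Lemma widen_mpolyX l : widen_mpoly 'X_l = 'X_(lift i l).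
Proof. by rewrite /= mmapX mmap1U. Qed.

Lemma poly_of_mpolyC c : poly_of_mpoly c%:MP = c%:MP%:P.
Proof. exact: mmapC. Qed.

Lemma poly_of_mpolyXi : poly_of_mpoly 'X_i = 'X.
Proof. by rewrite /= mmapX mmap1U unlift_none. Qed.

Lemma poly_of_mpolyX l : poly_of_mpoly 'X_(lift i l) = ('X_l)%:P.
Proof. by rewrite /= mmapX mmap1U liftK. Qed.

Lemma poly_of_widen s : poly_of_mpoly (widen_mpoly s) = s%:P.
Proof.
have := @mpoly_rmorph_ext _ _ _ (poly_of_mpoly \o widen_mpoly : {rmorphism _ -> _})
  (polyC : {rmorphism _ -> _}).
apply=> [c|l] /=; first by rewrite widen_mpolyC poly_of_mpolyC.
by rewrite widen_mpolyX poly_of_mpolyX.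
Qed.

Variables (p : nat) (chark : p \in [pchar k]).
Variables (R : comNzRingType) (pi : {rmorphism {mpoly k[n.+1]} -> R}).
Variables (F : {mpoly k[n.+1]}) (G : {mpoly k[n]}).
Hypotheses (FE : F = 'X_i ^+ p + widen_mpoly G).
Hypotheses (pi_surj : forall r, exists h, pi h = r).
Hypotheses (pi_ker : forall h, pi h = 0 <-> exists a, h = a * F).

(** As a polynomial in its [i]-th variable, [F] is monic of degree p, so division by it
    shows that the powers of that variable below p form a basis of [R] over the
    polynomials in the other variables; the p-th power of the variable is - G. *)
Lemma FFRT_hypersurface : finite_degree (@pth_power p k) -> FFRT p R.
Proof.
move=> degk; have p_gt0 : (0 < p)%N := prime_gt0 (pcharf_prime chark).
pose S : comNzRingType := {mpoly k[n]}.
have charS : p \in [pchar S] by apply: rmorph_pchar (@mpolyC n k) _ chark.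
have charR : p \in [pchar R].
  by apply: rmorph_pchar pi _ _; apply: rmorph_pchar (@mpolyC n.+1 k) _ chark.
pose j : {rmorphism S -> R} := pi \o widen_mpoly.
pose x := pi 'X_i.
have xp : x ^+ p = - j G.
  have /eqP : pi F = 0 by apply/pi_ker; exists 1; rewrite mul1r.
  by rewrite FE rmorphD rmorphXn addr_eq0 => /eqP.
have piE h : pi h = (map_poly j (poly_of_mpoly h)).[x].
  have := @mpoly_rmorph_ext _ _ _ pi
    (horner_eval x \o (map_poly j \o poly_of_mpoly) : {rmorphism _ -> _}).
  apply=> [c|l] /=; rewrite /horner_eval.
    by rewrite poly_of_mpolyC map_polyC hornerC /= widen_mpolyC.
  case: (unliftP i l) => [l'|] ->.
    by rewrite poly_of_mpolyX map_polyC hornerC /= widen_mpolyX.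
  by rewrite poly_of_mpolyXi map_polyX hornerX.
pose D : {poly S} := 'X^p + G%:P.
have polyF : poly_of_mpoly F = D.
  by rewrite FE rmorphD rmorphXn poly_of_mpolyXi poly_of_widen.
have monD : D \is monic by rewrite /D -[G]opprK rmorphN; apply: monicXnsubC.
have szD : size D = p.+1 by rewrite /D -[G]opprK rmorphN; apply: size_XnsubC.
have Dx : (map_poly j D).[x] = 0.
  by rewrite -polyF -piE; apply/pi_ker; exists 1; rewrite mul1r.
have indep_x : independent j (fun l : 'I_p => x ^+ l).
  move=> t t0.
  have [|a aF] := (pi_ker (\sum_(l < p) widen_mpoly (t l) * 'X_i ^+ l)).1.
    by rewrite rmorph_sum -[RHS]t0; apply: eq_bigr => l _; rewrite rmorphM rmorphXn.
  pose Q : {poly S} := \poly_(l < p) (if insub l is Some l' then t l' else 0).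
  have QE (l : 'I_p) : Q`_l = t l by rewrite coef_poly ltn_ord valK.
  have QD : Q = poly_of_mpoly a * D.
    rewrite -polyF -rmorphM -aF rmorph_sum /Q poly_def; apply: eq_bigr => l _.
    by rewrite rmorphM rmorphXn poly_of_widen poly_of_mpolyXi mul_polyC valK.
  suff Q0 : Q = 0 by move=> l; rewrite -QE Q0 coef0.
  apply/eqP; apply: contraT => Q_neq0.
  have a_neq0 : poly_of_mpoly a != 0 by apply: contraNneq Q_neq0 => a0; rewrite QD a0 mul0r.
  have : (size Q <= p)%N by apply: size_poly.
  rewrite QD size_Mmonic // szD addnS /= leqNgt => /negP[].
  by rewrite -{1}[p]add0n ltn_add2r size_poly_gt0.
have powR r : exists s, j s = r ^+ (p ^ 1).
  have [h <-] := pi_surj r; exists (map_poly (frobX charS 1) (poly_of_mpoly h)).[- G].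
  rewrite -(frobXE charR) piE -[RHS]horner_map -horner_map -!map_poly_comp.
  rewrite frobXE expn1 xp rmorphN; congr (_.[_]); apply: eq_map_poly => s /=.
  by rewrite !frobE rmorphXn rmorphXn.
have j_inj : injective j.
  move=> s s' ss'; apply/eqP; rewrite -subr_eq0; apply/eqP.
  have sum0 : \sum_(l < p) j (if l == Ordinal p_gt0 then s - s' else 0) * x ^+ l = 0.
    have j0 : j (s - s') = 0 by rewrite rmorphB ss' subrr.
    rewrite (bigD1 (Ordinal p_gt0)) // eqxx j0 mul0r big1; first exact: addr0.
    by move=> l /negPf->; rewrite rmorph0 mul0r.
  by have := indep_x _ sum0 (Ordinal p_gt0); rewrite /= ?eqxx.
apply: (FFRT_criterion charR j_inj powR) (polynomial_frob_free chark charS degk) _.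
split; last exact: indep_x.
move=> r; have [h <-] := pi_surj r; rewrite piE.
exact: monic_spanning monD szD Dx _.
Qed.
End OneVariable.

Section BrieskornSurface.
Variables (k : fieldType) (p : nat) (chark : p \in [pchar k]).

Lemma FFRT_x2y3z7 : finite_degree (@pth_power p k) -> p \in [:: 2; 3; 7]%N ->
  FFRT p (x2y3z7_ring k).
Proof.
move=> degk p237; pose R := x2y3z7_ring k.
pose q : {rmorphism {mpoly k[3]} -> R} := \pi_R%qT.
have q_surj r : exists h, q h = r by exists (repr r); apply: reprK.
have q_ker h : q h = 0 <-> exists a, h = a * x2y3z7 k.
  have -> : (q h = 0) <-> (h \in @x2y3z7_ideal k).
    rewrite -[h in X in _ <-> X]subr0 Quotient.idealrBE -(rmorph0 q).
    by split=> [/eqP|/eqP].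
  by split=> /asboolP.
have hyp i G : x2y3z7 k = 'X_i ^+ p + widen_mpoly k i G -> FFRT p R.
  by move=> FE; apply: (FFRT_hypersurface chark FE q_surj q_ker degk).
pose o0 : 'I_2 := ord0; pose o1 : 'I_2 := ord_max.
have liftE (i l : 'I_3) (m : 'I_2) : lift i m = l :> nat ->
    widen_mpoly k i 'X_m = 'X_l.
  by move=> e; rewrite widen_mpolyX; congr ('X__); apply: val_inj.
pose vx : 'I_3 := @Ordinal 3 0 isT.
pose vy : 'I_3 := @Ordinal 3 1 isT.
pose vz : 'I_3 := @Ordinal 3 2 isT.
have FE : x2y3z7 k = 'X_vx ^+ 2 + 'X_vy ^+ 3 + 'X_vz ^+ 7 by [].
move: p237 hyp; rewrite !inE => /or3P[]/eqP-> hyp.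
- apply: (hyp vx ('X_o0 ^+ 3 + 'X_o1 ^+ 7)).
  by rewrite rmorphD !rmorphXn (@liftE _ vy) // (@liftE _ vz) // FE addrA.
- apply: (hyp vy ('X_o0 ^+ 2 + 'X_o1 ^+ 7)).
  by rewrite rmorphD !rmorphXn (@liftE _ vx) // (@liftE _ vz) // FE; ring.
- apply: (hyp vz ('X_o0 ^+ 2 + 'X_o1 ^+ 3)).
  by rewrite rmorphD !rmorphXn (@liftE _ vx) // (@liftE _ vy) // FE; ring.
Qed.
End BrieskornSurface.

Theorem mainTheorem4 (p : nat) :
  (* regular local case *)
  (forall (S : idomainType) (L : closedFieldType)
     (iota : {rmorphism {fraction S} -> L}) (f : S) (e : nat) (g : L),
     p \in [pchar S] -> regular_local S -> F_finite p S ->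
     algebraic_closure iota ->
     g ^+ (p ^ e) = to_closure iota f ->
     FFRT p (adjoin (to_closure iota) g))
  /\
  (* graded polynomial ring case *)
  (forall (k : fieldType) (n : nat) (w : 'I_n -> nat) (L : closedFieldType)
     (iota : {rmorphism {fraction {mpoly k[n]}} -> L})
     (f : {mpoly k[n]}) (e : nat) (g : L),
     p \in [pchar k] -> finite_degree (@pth_power p k) ->
     (forall i, (0 < w i)%N) -> whomogeneous w f ->
     algebraic_closure iota ->
     g ^+ (p ^ e) = to_closure iota f ->
     FFRT p (adjoin (to_closure iota) g))
  /\
  (forall k : fieldType,
     p \in [pchar k] -> finite_degree (@pth_power p k) ->
     p \in [:: 2; 3; 7]%N ->
     FFRT p (x2y3z7_ring k)).
Proof.
have to_closure_inj (S : idomainType) (L : closedFieldType)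
    (iota : {rmorphism {fraction S} -> L}) : injective (to_closure iota).
  by apply: inj_comp; [exact: fmorph_inj | move=> x y /eqP; rewrite tofrac_eq => /eqP].
split=> [S L iota f e g charS regS finS _ ge|].
  apply: (FFRT_adjoin (charS := charS) (to_closure_inj _ _ _) _ ge).
  exact: kunz_regular_local.
split=> [k n w L iota f e g chark degk _ _ _ ge|k chark degk p237].
  have charM : p \in [pchar {mpoly k[n]}] by apply: rmorph_pchar (@mpolyC n k) _ chark.
  apply: (FFRT_adjoin (charS := charM) (to_closure_inj _ _ _) _ ge).
  exact: polynomial_frob_free chark charM degk.
exact: FFRT_x2y3z7.
Qed.
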